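(* Assume the boundedness hypotheses on $f$ and $g$ stated in the context. Then, for every sufficiently small time step $h=T/N$ and every sufficiently large number of samples $N_s$, the following hold. (Bias estimation) $$\|\mathbb{E}(u_{N}-\widetilde{u}_{N})\|_2 \le \left[ \frac{h^2}{N_s}\big( e^{\alpha T}-1\big) + \alpha T \Big( \frac{h}{N_s} + \frac{\alpha^2 h^4}{s^2 R^2 N_s^2}\, |u_{\mathrm{RK}}|_{\mathrm{std}}^2 \Big) \big(e^{\max(\alpha,\beta) T} -1\big) \right] |u_{\mathrm{RK}}|_{\mathrm{std}}^2 .$$ (Numerical error estimation) $$\mathbb{E}(\|u_N-\widetilde{u}_N\|_2^2) \le \big( e^{\beta T}-1\big) \Big( \frac{h}{N_s} + \frac{\alpha^2 h^4}{s^2 R^2 N_s^2}\, |u_{\mathrm{RK}}|_{\mathrm{std}}^2 \Big) |u_{\mathrm{RK}}|_{\mathrm{std}}^2 .$$ Here $\alpha = 2^s sR\sqrt{d}\, \max(M',\, 2 s M'',\, 2^{s+2} s^3 M'^2 M'' R^2,\, 2^{s+1} s^2M'' R^2)$ and $\beta = \max(4+2^{s+3}M'^2 d R^2 s^3,\, 2^{s+1} R^2 s^2)$.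
   Context: Let $T>0$, $d\ge 1$, and consider the ODE $\frac{du}{dt}=f(t,u(t))$, $t\in[0,T]$, for $u:[0,T]\to\mathbb{C}^d$ with given initial value $u(0)$, where $f$ is $(p+1)$-times continuously differentiable. Let $X$ be a random variable with a given distribution and $g$ a function with $f(t,u)=\mathbb{E}_X[g(t,u,X)]$ for all $t,u$. Deterministic scheme: fix an $s$-stage explicit Runge--Kutta method of order $p$ with coefficients $a_{ij},b_i,c_i$, and let $h=T/N<1$, $t_n=nh$. Set $u_0=u(0)$ and $$u_{n+1}=u_n+h\sum_{i=1}^s b_ik_i,\qquad k_i=f\Big(t_n+c_ih,\,u_n+h\sum_{j=1}^{i-1}a_{ij}k_j\Big),\quad i=1,\dots,s.$$ Stochastic scheme: set $\widetilde u_0=u(0)$ and $$\widetilde u_{n+1}=\widetilde u_n+h\sum_{i=1}^s b_i\widetilde k_i,\qquad \widetilde k_i=\frac1{N_s}\sum_{l=1}^{N_s} g\Big(t_n+c_ih,\,\widetilde u_n+h\sum_{j=1}^{i-1}a_{ij}\widetilde k_j,\,X_l^{(i)}\Big),$$ where the $X_l^{(i)}$ are independent samples of $X$ (drawn afresh at every time step). Boundedness hypotheses: with superscript $(m)$ denoting the $m$th component, there are constants $M',M''$ independent of $t,u,X$ such that for all $m$, $t,u,X$: $\|\nabla_u g^{(m)}(t,u,X)\|_2\le M'$, $\|\nabla_u f^{(m)}(t,u)\|_2\le M'$, $\|\nabla_u^2 f^{(m)}(t,u)\|_{\mathrm F}\le M''$ (Frobenius norm of the Hessian). The constant $R$ satisfies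 $|a_{ij}|,|b_i|,|c_i|\le R$ for all $i,j$. Notation: $|u^{(m)}_{\mathrm{RK}}|_{\mathrm{std}}=\max_n\max_{i=1,\dots,s}\sqrt{\operatorname{Var} g^{(m)}\big(t_n+c_ih,\,u_n+h\sum_{j=1}^{i-1}a_{ij}k_j,\,X\big)}$ (with $u_n,k_j$ from the deterministic scheme) and $|u_{\mathrm{RK}}|_{\mathrm{std}}=\big(\sum_{m=1}^d|u^{(m)}_{\mathrm{RK}}|_{\mathrm{std}}^2\big)^{1/2}$. ''Sufficiently small $h$ and sufficiently large $N_s$'' means: there exist thresholds $h_0>0$, $N_0$ such that the assertion holds for all $h=T/N\le h_0$ and $N_s\ge N_0$. *)

(* Defs.v *)
From mathcomp Require Import all_boot all_order all_algebra.
From mathcomp Require Import complex.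
From mathcomp Require Import all_classical all_reals all_analysis.
Import Order.TTheory GRing.Theory Num.Theory.
Import numFieldNormedType.Exports.

Set Implicit Arguments.
Unset Strict Implicit.
Unset Printing Implicit Defensive.

Local Open Scope classical_set_scope.
Local Open Scope ring_scope.

Notation "''CV[' R ]_ d" := 'rV[complex R]_d
  (at level 0, d at level 2, format "''CV[' R ]_ d") : type_scope.

Section ComplexVectors.
Variable R : realType.

Definition norm2 d (v : 'CV[R]_d) : R :=
  Num.sqrt (\sum_m (complex.Re (v 0 m) ^+ 2 + complex.Im (v 0 m) ^+ 2)).

Definition rscale d (r : R) (v : 'CV[R]_d) : 'CV[R]_d := r%:C%C *: v.

(* The identification of C^d with R^(2d): first all real parts, then all
   imaginary parts. *)
Definition realify d (v : 'CV[R]_d) : 'rV[R]_(d + d) :=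
  row_mx (map_mx (@complex.Re R) v) (map_mx (@complex.Im R) v).

Definition complexify d (x : 'rV[R]_(d + d)) : 'CV[R]_d :=
  \row_m (lsubmx x 0 m +i* rsubmx x 0 m)%C.

End ComplexVectors.

Section Smoothness.
Variable R : realType.

(* On a finite-dimensional V this is the usual class C^k: all iterated
   (directional, equivalently partial) derivatives up to order k exist
   everywhere and are continuous. *)
Fixpoint Ck (V W : normedModType R) (k : nat) (F : V -> W) : Prop :=
  if k is k'.+1 then
    [/\ continuous F,
        forall v x, derivable F x v &
        forall v, Ck k' ('D_v F)]
  else continuous F.

(* Smoothness is understood over the real numbers, i.e. with respect to t and
   the 2d real coordinates of u.  (Complex differentiability in u would be too
   strong: by Liouville, a holomorphic function on C^d with bounded gradient is
   affine.)  On a time set J that need not be open, f is of class C^k on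
   J x C^d when it is the restriction of a C^k function on R x C^d; for
   J = [0, T] this is smoothness up to the boundary, with one-sided
   derivatives in t at the endpoints. *)
Definition Ck_on d (J : set R) (k : nat) (f : R -> 'CV[R]_d -> 'CV[R]_d) :=
  exists F : R -> 'CV[R]_d -> 'CV[R]_d,
    (forall t u, J t -> F t u = f t u) /\
    @Ck (R * 'rV[R]_(d + d))%type 'rV[R]_(d + d) k
      (fun z => realify (F z.1 (complexify z.2))).

Definition coordRe d (F : 'CV[R]_d -> R[i]) (x : 'rV[R]_(d + d)) : R :=
  complex.Re (F (complexify x)).
Definition coordIm d (F : 'CV[R]_d -> R[i]) (x : 'rV[R]_(d + d)) : R :=
  complex.Im (F (complexify x)).

Definition rdifferentiable d (F : 'CV[R]_d -> R[i]) (u : 'CV[R]_d) : Prop :=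
  differentiable (coordRe F) (realify u) /\
  differentiable (coordIm F) (realify u).

Definition partial n (j : 'I_n) (phi : 'rV[R]_n -> R) : 'rV[R]_n -> R :=
  'D_(delta_mx 0 j) phi.

(* The Euclidean norm of the gradient of F : C^d -> C, a vector of C^(2d) whose
   entries are the derivatives of F with respect to the real coordinates. *)
Definition grad_norm d (F : 'CV[R]_d -> R[i]) (u : 'CV[R]_d) : R :=
  Num.sqrt (\sum_j (partial j (coordRe F) (realify u) ^+ 2 +
                    partial j (coordIm F) (realify u) ^+ 2)).

(* The Frobenius norm of the Hessian of F : C^d -> C, a 2d x 2d complex
   matrix. *)
Definition hess_norm d (F : 'CV[R]_d -> R[i]) (u : 'CV[R]_d) : R :=
  Num.sqrt (\sum_j \sum_k
    (partial j (partial k (coordRe F)) (realify u) ^+ 2 +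
     partial j (partial k (coordIm F)) (realify u) ^+ 2)).

End Smoothness.

Section RungeKutta.
Variable R : realType.

(* Only the entries rk_a i j with j < i are ever used. *)
Record explicit_rk (s : nat) := ExplicitRK {
  rk_a : 'I_s -> 'I_s -> R;
  rk_b : 'I_s -> R;
  rk_c : 'I_s -> R }.

Variables (s : nat) (tab : explicit_rk s) (d : nat).

Definition rk_arg (h : R) (u : 'CV[R]_d) (k : 'I_s -> 'CV[R]_d) (i : 'I_s) :
    'CV[R]_d :=
  u + rscale h (\sum_(j < s | (j < i)%N) rscale (rk_a tab i j) (k j)).

(* F i is the slope function of the i-th stage.  Since the i-th stage depends
   on the previous ones only, s rounds of substitution starting from arbitrary
   values compute all the stages; see rk_stagesE. *)
Definition rk_stages (h : R) (F : 'I_s -> 'CV[R]_d -> 'CV[R]_d)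
    (u : 'CV[R]_d) : 'I_s -> 'CV[R]_d :=
  iter s (fun k i => F i (rk_arg h u k i)) (fun=> 0).

Lemma rk_stagesE h F u i :
  rk_stages h F u i = F i (rk_arg h u (rk_stages h F u) i).
Proof.
rewrite /rk_stages; set step := (fun k i => _).
suff stable n m (j : 'I_s) : (j < n)%N -> (j < m)%N ->
    iter n step (fun=> 0) j = iter m step (fun=> 0) j.
  by rewrite -[RHS]/(iter s.+1 step (fun=> 0) i) (stable s s.+1) // ltnS ltnW.
elim: n m j => // n IHn [//|m] j jn jm; rewrite !iterS /step /rk_arg.
congr (F j (_ + rscale _ _)); apply: eq_bigr => l lj; congr rscale.
by apply: IHn; [exact: leq_trans lj jn | exact: leq_trans lj jm].
Qed.

Definition rk_step (h : R) (F : 'I_s -> 'CV[R]_d -> 'CV[R]_d)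
    (u : 'CV[R]_d) : 'CV[R]_d :=
  u + rscale h (\sum_i rscale (rk_b tab i) (rk_stages h F u i)).

(* F n i is the slope function of the i-th stage of the n-th step. *)
Fixpoint rk_sol (h : R) (F : nat -> 'I_s -> 'CV[R]_d -> 'CV[R]_d)
    (u0 : 'CV[R]_d) (n : nat) : 'CV[R]_d :=
  if n is n'.+1 then rk_step h (F n') (rk_sol h F u0 n') else u0.

Definition stage_time (h : R) (n : nat) (i : 'I_s) : R :=
  n%:R * h + rk_c tab i * h.

Definition det_slope (f : R -> 'CV[R]_d -> 'CV[R]_d) (h : R) (n : nat)
    (i : 'I_s) (v : 'CV[R]_d) : 'CV[R]_d :=
  f (stage_time h n i) v.

(* x n i l is the l-th sample used in the i-th stage of the n-th step. *)
Definition mc_slope (E : Type) (g : R -> 'CV[R]_d -> E -> 'CV[R]_d) (h : R)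
    (Ns : nat) (x : nat -> 'I_s -> 'I_Ns -> E) (n : nat) (i : 'I_s)
    (v : 'CV[R]_d) : 'CV[R]_d :=
  rscale (Ns%:R^-1) (\sum_l g (stage_time h n i) v (x n i l)).

Definition det_sol (f : R -> 'CV[R]_d -> 'CV[R]_d) (h : R) (u0 : 'CV[R]_d) :
    nat -> 'CV[R]_d :=
  rk_sol h (det_slope f h) u0.

Definition mc_sol (E : Type) (g : R -> 'CV[R]_d -> E -> 'CV[R]_d) (h : R)
    (u0 : 'CV[R]_d) (Ns : nat) (x : nat -> 'I_s -> 'I_Ns -> E) :
    nat -> 'CV[R]_d :=
  rk_sol h (mc_slope g h x) u0.

Definition det_arg (f : R -> 'CV[R]_d -> 'CV[R]_d) (h : R) (u0 : 'CV[R]_d)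
    (n : nat) (i : 'I_s) : 'CV[R]_d :=
  let u := det_sol f h u0 n in
  rk_arg h u (rk_stages h (det_slope f h n) u) i.

End RungeKutta.

(* The method has order (at least) p: for every C^(p+1) system, one step started
   on an exact solution y at t0 has an error O(h^(p+1)). *)
Definition rk_order (R : realType) (s : nat) (tab : explicit_rk R s)
    (p : nat) : Prop :=
  forall (d : nat) (f : R -> 'CV[R]_d -> 'CV[R]_d), Ck_on setT p.+1 f ->
  forall (t0 delta : R) (y : R -> 'CV[R]_d), 0 < delta ->
  (forall t : R, `|t - t0| < delta ->
     is_derive t 1 (fun r => realify (y r)) (realify (f t (y t)))) ->
  exists K h1 : R, 0 < h1 /\
    forall h : R, 0 < h -> h < h1 ->
      norm2 (y (t0 + h) -
             rk_step tab h (fun i => f (t0 + rk_c tab i * h)) (y t0))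
      <= K * h ^+ p.+1.

Section Probability.
Context d (Omega : measurableType d) (R : realType) (P : probability Omega R).

(* E[Z] = z for complex-valued Z with measurable real and imaginary parts.  As
   the integral takes an infinite value on non-integrable real functions, this
   entails that Z is integrable. *)
Definition has_expectation (Z : Omega -> R[i]) (z : R[i]) : Prop :=
  ('E_P[fun w => complex.Re (Z w)] = (complex.Re z)%:E)%E /\
  ('E_P[fun w => complex.Im (Z w)] = (complex.Im z)%:E)%E.

(* The norm of the expectation of a random vector of C^d; the value is +oo if a
   coordinate is not integrable. *)
Definition norm2_expectation n (Z : Omega -> 'CV[R]_n) : \bar R :=
  sqrte (\sum_m ('E_P[fun w => complex.Re (Z w ord0 m)] ^+ 2 +
                 'E_P[fun w => complex.Im (Z w ord0 m)] ^+ 2))%E.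

(* Var Z = E|Z - E Z|^2. *)
Definition cvariance (Z : Omega -> R[i]) : \bar R :=
  let a := fine 'E_P[fun w => complex.Re (Z w)] in
  let b := fine 'E_P[fun w => complex.Im (Z w)] in
  'E_P[fun w => (complex.Re (Z w) - a) ^+ 2 + (complex.Im (Z w) - b) ^+ 2].

(* Mutual independence of a finite family of random variables. *)
Definition mutually_independent d' (E : measurableType d') (I : finType)
    (Y : I -> {RV P >-> E}) : Prop :=
  forall (J : {set I}) (A : I -> set E),
    (forall k, measurable (A k)) ->
    P (\bigcap_(k in [set k | k \in J]) (Y k @^-1` A k)) =
    (\prod_(k in J) P (Y k @^-1` A k))%E.

Definition same_law d1 (Omega1 : measurableType d1) (P1 : probability Omega1 R)
    d' (E : measurableType d') (Y : {RV P >-> E}) (X : {RV P1 >-> E}) : Prop :=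
  forall A : set E, measurable A -> distribution P Y A = distribution P1 X A.

(* The samples x n i l for n < N are independent copies of X. *)
Definition iid_samples d1 (Omega1 : measurableType d1)
    (P1 : probability Omega1 R) d' (E : measurableType d')
    (X : {RV P1 >-> E}) (N s Ns : nat)
    (x : nat -> 'I_s -> 'I_Ns -> {RV P >-> E}) : Prop :=
  (forall n i l, (n < N)%N -> same_law (x n i l) X) /\
  mutually_independent (fun k : 'I_N * 'I_s * 'I_Ns => x k.1.1 k.1.2 k.2).

End Probability.

Section Std.
Context d0 (Omega : measurableType d0) (R : realType) (P : probability Omega R).
Context d' (E : measurableType d') (X : {RV P >-> E}).
Context s (tab : explicit_rk R s) d (f : R -> 'CV[R]_d -> 'CV[R]_d).
Context (g : R -> 'CV[R]_d -> E -> 'CV[R]_d) (h : R) (u0 : 'CV[R]_d) (N : nat).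

(* The maximum is over the N steps n = 0, ..., N - 1 of the scheme. *)
Definition rk_std_coord (m : 'I_d) : \bar R :=
  \big[maxe/0%E]_(n < N) \big[maxe/0%E]_(i < s)
    sqrte (cvariance P (fun w =>
      g (stage_time tab h n i) (det_arg tab f h u0 n i) (X w) 0 m)).

Definition rk_std : \bar R := sqrte (\sum_m rk_std_coord m ^+ 2)%E.

End Std.

Definition rk_alpha (R : realType) (s d : nat) (M1 M2 Rb : R) : R :=
  2 ^+ s * s%:R * Rb * Num.sqrt d%:R *
  Num.max M1 (Num.max (2 * s%:R * M2)
    (Num.max (2 ^+ (s + 2) * s%:R ^+ 3 * M1 ^+ 2 * M2 * Rb ^+ 2)
             (2 ^+ (s + 1) * s%:R ^+ 2 * M2 * Rb ^+ 2))).

Definition rk_beta (R : realType) (s d : nat) (M1 Rb : R) : R :=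
  Num.max (4 + 2 ^+ (s + 3) * M1 ^+ 2 * d%:R * Rb ^+ 2 * s%:R ^+ 3)
          (2 ^+ (s + 1) * Rb ^+ 2 * s%:R ^+ 2).

(* Main.v *)
Require Import Defs.
From mathcomp Require Import all_boot all_order all_algebra.
From mathcomp Require Import complex.
From mathcomp Require Import all_classical all_reals all_analysis.
From mathcomp Require Import measurable_realfun.
From mathcomp Require Import ring lra.
Import Order.TTheory GRing.Theory Num.Theory.
Import numFieldNormedType.Exports.

Set Implicit Arguments.
Unset Strict Implicit.
Unset Printing Implicit Defensive.

Local Open Scope classical_set_scope.
Local Open Scope ring_scope.

(** Let e_n be the difference of the stochastic and the deterministic solution
    after n steps, and write sigma for the norm of the standard deviations. In
    one step the error changes by h times a combination of the errors of the
    slopes, and each slope error is split in two different ways.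

    - At the random argument of the stage, it is the difference of the exact
      slopes f plus a Monte Carlo error with fresh samples. The samples are
      independent of the argument and of e_n, so the Monte Carlo error has mean
      zero and is orthogonal to e_n ([fresh_noise_mean0], [slope_drift_orth]).
      Independence is used in the following form: the other samples generate a
      sigma-algebra which is independent of the fresh sample, and Fubini's
      theorem applies on the product ([fresh_sample_expectation0]).
    - At the deterministic argument, it is a Monte Carlo error whose variance is
      at most sigma^2 / N_s ([det_noise_var]), plus an increment of g which the
      gradient bound controls.

    For small h the recursion through the stages costs only a factor close to 1,
    and this gives ([mean_square_step])
      E|e_{n+1}|^2 <= (1 + beta h) E|e_n|^2 + beta h^2 sigma^2 / N_s.
    Only the mean differences of exact slopes enter the bias. A Taylor expansion of f
    turns these into a linear function of the mean error, with a remainder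
    bounded by the Hessian times the mean square error ([bias_step]):
      |E e_{n+1}| <= (1 + alpha h) |E e_n|
                     + alpha h (E|e_n|^2 + h^2 sigma^2 / N_s).
    The two bounds follow by induction on n ([mean_square_gronwall],
    [bias_gronwall]). Throughout, C^d is treated as R^(2d), which costs a factor
    sqrt 2 in the Lipschitz constants; the powers of 2 in alpha and beta absorb
    it together with the constants produced by the stages.

    If sigma is infinite, both right-hand sides are infinite, except the first
    one when alpha = 0. In that case g does not depend on u, or the method has
    zero weights, and the bias vanishes ([noiseless_mean]). *)

(** * Euclidean norm of finite families *)

Section Euclid.
Context (R : rcfType) (I : finType).
Implicit Types x y : I -> R.

Definition l2 x : R := Num.sqrt (\sum_i x i ^+ 2).

Lemma l2_ge0 x : 0 <= l2 x.
Proof. exact: sqrtr_ge0. Qed.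

Lemma l2_sq x : l2 x ^+ 2 = \sum_i x i ^+ 2.
Proof. by rewrite sqr_sqrtr// sumr_ge0// => i _; exact: sqr_ge0. Qed.

Lemma eq_l2 x y : x =1 y -> l2 x = l2 y.
Proof. by move=> xy; congr Num.sqrt; apply: eq_bigr => i _; rewrite xy. Qed.

Lemma l2_coord x i : `|x i| <= l2 x.
Proof.
rewrite -(@ler_pXn2r _ 2)// ?nnegrE ?l2_ge0// real_normK ?num_real// l2_sq.
by rewrite (bigD1 i)//= lerDl sumr_ge0// => j _; exact: sqr_ge0.
Qed.

Lemma l2_le x (c : R) : 0 <= c -> \sum_i x i ^+ 2 <= c ^+ 2 -> l2 x <= c.
Proof. by move=> c0 h; rewrite -(ger0_norm c0) -sqrtr_sqr; exact: ler_wsqrtr. Qed.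

(** The passage from bounds on single coordinates to a bound on a vector of
    C^d = R^(2d); this is where the factor sqrt d of alpha comes from. *)
Lemma l2_coord_le x (c : R) : 0 <= c -> (forall i, `|x i| <= c) ->
  l2 x <= Num.sqrt #|I|%:R * c.
Proof.
move=> c0 xc; apply: l2_le; first by rewrite mulr_ge0 ?sqrtr_ge0.
rewrite exprMn sqr_sqrtr// mulr_natl -sumr_const; apply: ler_sum => i _.
by rewrite -real_normK ?num_real// lerXn2r ?nnegrE.
Qed.

Lemma l2_0 : l2 (fun=> 0) = 0.
Proof. by rewrite /l2 big1 ?sqrtr0// => i _; rewrite expr0n. Qed.

(** If both norms are positive, expand the sum of the squares of
    l2 y * x i - l2 x * y i, which is nonnegative. *)
Lemma CauchySchwarz x y : \sum_i x i * y i <= l2 x * l2 y.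
Proof.
have z0 x' y' : l2 x' = 0 -> \sum_i x' i * y' i = 0.
  move=> x0; apply: big1 => i _.
  by have := l2_coord x' i; rewrite x0 normr_le0 => /eqP ->; rewrite mul0r.
have [x0|x0] := eqVneq (l2 x) 0; first by rewrite x0 mul0r z0.
have [y0|y0] := eqVneq (l2 y) 0.
  by rewrite y0 mulr0; under eq_bigr do rewrite mulrC; rewrite z0.
have ab : 0 < l2 x * l2 y by rewrite mulr_gt0// lt0r ?x0 ?y0 l2_ge0.
have : 0 <= \sum_i (l2 y * x i - l2 x * y i) ^+ 2.
  by apply: sumr_ge0 => i _; exact: sqr_ge0.
have -> : \sum_i (l2 y * x i - l2 x * y i) ^+ 2 =
    l2 y ^+ 2 * (\sum_i x i ^+ 2) + l2 x ^+ 2 * (\sum_i y i ^+ 2)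
    - 2 * (l2 x * l2 y) * \sum_i x i * y i.
  by rewrite !mulr_sumr -sumrN -!big_split/=; apply: eq_bigr => i _; ring.
rewrite -!l2_sq => h; rewrite -(ler_pM2l ab); nra.
Qed.

Lemma l2D x y : l2 (fun i => x i + y i) <= l2 x + l2 y.
Proof.
apply: l2_le; first by rewrite addr_ge0 ?l2_ge0.
have -> : \sum_i (x i + y i) ^+ 2 =
    \sum_i x i ^+ 2 + \sum_i y i ^+ 2 + 2 * \sum_i x i * y i.
  by rewrite mulr_sumr -!big_split/=; apply: eq_bigr => i _; ring.
rewrite -!l2_sq; have := CauchySchwarz x y; nra.
Qed.

Lemma l2Z (a : R) x : l2 (fun i => a * x i) = `|a| * l2 x.
Proof.
rewrite /l2 -sqrtr_sqr -sqrtrM ?sqr_ge0// mulr_sumr; congr Num.sqrt.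
by apply: eq_bigr => i _; rewrite exprMn.
Qed.

Lemma l2N x : l2 (fun i => - x i) = l2 x.
Proof. by rewrite /l2; under eq_bigr do rewrite sqrrN. Qed.

Lemma l2_sum (J : finType) (p : pred J) (F : J -> I -> R) :
  l2 (fun i => \sum_(j | p j) F j i) <= \sum_(j | p j) l2 (F j).
Proof.
rewrite unlock /reducebig; elim: (index_enum J) => [|j s IH] /=; first by rewrite l2_0.
case: (p j) => //; apply: le_trans (l2D (F j) _) _; exact: lerD.
Qed.

End Euclid.

Lemma sqr_sum_le (R : rcfType) (J : finType) (z : J -> R) :
  (\sum_j z j) ^+ 2 <= #|J|%:R * \sum_j z j ^+ 2.
Proof.
have := CauchySchwarz (fun=> 1) (fun j => `|z j|).
under eq_bigr do rewrite mul1r.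
move=> /(@lerXn2r _ 2%N); rewrite !nnegrE => h.
apply: (@le_trans _ _ ((\sum_j `|z j|) ^+ 2)).
  rewrite -real_normK ?num_real// lerXn2r ?nnegrE ?sumr_ge0//.
  exact: ler_norm_sum.
apply: le_trans (h _ _) _; rewrite ?sumr_ge0 ?mulr_ge0 ?l2_ge0//.
rewrite exprMn !l2_sq; under eq_bigr do rewrite expr1n.
by under [X in _ * X <= _]eq_bigr do rewrite real_normK ?num_real//; rewrite sumr_const.
Qed.

(** * Means of real functions on a probability space *)

Section Expect.
Context d (T : measurableType d) (R : realType) (P : probability T R).
Implicit Types f g : T -> R.

Definition integ f := P.-integrable setT (EFin \o f).
(** Measurability is part of the definition because it does not follow from the
    measurability of the square. *)
Definition sqint f := measurable_fun setT f /\ integ (fun w => f w ^+ 2).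
(** The mean as a real number, so that inequalities between means are within
    reach of linear arithmetic; it has the junk value 0 on functions with an
    infinite expectation. *)
Definition Ex f : R := \int[P]_w f w.

Lemma integ_meas f : integ f -> measurable_fun setT f.
Proof. by move/measurable_int/measurable_EFinP. Qed.

Lemma integ_cst c : integ (fun=> c).
Proof. exact: finite_measure_integrable_cst. Qed.

Lemma integD f g : integ f -> integ g -> integ (fun w => f w + g w).
Proof. by move=> fi gi; apply: (eq_integrable _ _ _ _ (integrableD _ fi gi)). Qed.

Lemma integZ c f : integ f -> integ (fun w => c * f w).
Proof. move=> fi; have := integrableZl measurableT c fi.
by apply: eq_integrable. Qed.

Lemma integN f : integ f -> integ (fun w => - f w).
Proof. by move=> /(integZ (-1)); under eq_fun do rewrite mulN1r. Qed.

Lemma integB f g : integ f -> integ g -> integ (fun w => f w - g w).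
Proof. by move=> fi /integN gi; exact: integD. Qed.

Lemma integ_sum (J : finType) (p : pred J) (F : J -> T -> R) :
  (forall j, p j -> integ (F j)) -> integ (fun w => \sum_(j | p j) F j w).
Proof.
move=> iF; rewrite unlock /reducebig; elim: (index_enum J) => [|j s IH] /=.
  exact: integ_cst.
have [pj|//] := boolP (p j); exact: integD (iF j pj) IH.
Qed.

Lemma integ_le f g : measurable_fun setT f -> (forall w, `|f w| <= g w) ->
  integ g -> integ f.
Proof.
move=> mf fg ig; apply: (le_integrable measurableT _ _ ig).
  exact/measurable_EFinP.
by move=> w _ /=; rewrite lee_fin (le_trans (fg w))// ler_norm.
Qed.

Lemma ExD f g : integ f -> integ g -> Ex (fun w => f w + g w) = Ex f + Ex g.
Proof. exact: RintegralD. Qed.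

Lemma ExZ c f : integ f -> Ex (fun w => c * f w) = c * Ex f.
Proof. exact: RintegralZl. Qed.

Lemma ExN f : integ f -> Ex (fun w => - f w) = - Ex f.
Proof. by move=> /(ExZ (-1)); rewrite mulN1r; under eq_fun do rewrite mulN1r. Qed.

Lemma ExB f g : integ f -> integ g -> Ex (fun w => f w - g w) = Ex f - Ex g.
Proof. exact: RintegralB. Qed.

Lemma Ex_cst c : Ex (fun=> c) = c.
Proof. by rewrite /Ex Rintegral_cst//= -[RHS]mulr1; congr (_ * _);
  rewrite (@probability_setT _ _ _ P). Qed.

Lemma Ex_sum (J : finType) (p : pred J) (F : J -> T -> R) :
  (forall j, p j -> integ (F j)) ->
  Ex (fun w => \sum_(j | p j) F j w) = \sum_(j | p j) Ex (F j).
Proof.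
move=> iF; apply/esym; rewrite unlock /reducebig.
elim: (index_enum J) => [|j r IH] /=; first by rewrite Ex_cst.
have [pj|//] := boolP (p j); rewrite IH -ExD//; first exact: iF.
elim: r {IH} => [|i r IH] /=; first exact: integ_cst.
have [pi|//] := boolP (p i); exact: integD (iF i pi) IH.
Qed.

Lemma le_Ex f g : integ f -> integ g -> (forall w, f w <= g w) -> Ex f <= Ex g.
Proof. by move=> fi gi fg; apply: le_Rintegral. Qed.

Lemma Ex_ge0 f : (forall w, 0 <= f w) -> 0 <= Ex f.
Proof. by move=> f0; exact: Rintegral_ge0. Qed.

Lemma EFin_Ex f : integ f -> (\int[P]_w (f w)%:E)%E = (Ex f)%:E.
Proof. by move=> fi; rewrite fineK//; exact: integrable_fin_num. Qed.

Lemma expectationE f : integ f -> ('E_P[f] = (Ex f)%:E)%E.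
Proof. by move=> fi; rewrite unlock EFin_Ex. Qed.

Lemma sqint_le f g : measurable_fun setT f -> (forall w, f w ^+ 2 <= g w) ->
  integ g -> sqint f.
Proof.
move=> mf fg gi; split => //; apply: integ_le gi.
  exact: measurable_funX.
by move=> w; rewrite ger0_norm ?sqr_ge0.
Qed.

Lemma sqint_cst c : sqint (fun=> c).
Proof. by split; [exact: measurable_cst|exact: integ_cst]. Qed.

Lemma sqintM f g : sqint f -> sqint g -> integ (fun w => f w * g w).
Proof.
move=> [mf f2] [mg g2]; apply: integ_le (integD f2 g2).
  exact: measurable_funM.
move=> w; rewrite normrM -(real_normK (num_real (f w))) -(real_normK (num_real (g w))).
by have := sqr_ge0 (`|f w| - `|g w|); have := normr_ge0 (f w);
  have := normr_ge0 (g w); nra.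
Qed.

Lemma sqint_integ f : sqint f -> integ f.
Proof.
move=> sf; rewrite (_ : f = fun w => f w * 1); last by apply/funext => w; rewrite mulr1.
exact: sqintM sf (sqint_cst 1).
Qed.

Lemma sqintD f g : sqint f -> sqint g -> sqint (fun w => f w + g w).
Proof.
move=> [mf f2] [mg g2].
apply: sqint_le (integD (integZ 2 f2) (integZ 2 g2)).
  exact: measurable_funD.
by move=> w /=; have := sqr_ge0 (f w - g w); nra.
Qed.

Lemma sqintZ c f : sqint f -> sqint (fun w => c * f w).
Proof.
move=> [mf f2]; apply: sqint_le (integZ (c ^+ 2) f2).
  exact: measurable_funM.
by move=> w; rewrite exprMn.
Qed.

Lemma sqintB f g : sqint f -> sqint g -> sqint (fun w => f w - g w).
Proof.
move=> sf sg; rewrite (_ : (fun w => _) = fun w => f w + (-1) * g w).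
  exact: sqintD sf (sqintZ _ sg).
by apply/funext => w; rewrite mulN1r.
Qed.

Lemma sqint_sum (J : finType) (p : pred J) (F : J -> T -> R) :
  (forall j, p j -> sqint (F j)) -> sqint (fun w => \sum_(j | p j) F j w).
Proof.
move=> iF; rewrite unlock /reducebig; elim: (index_enum J) => [|j s IH] /=.
  exact: sqint_cst.
have [pj|//] := boolP (p j); exact: sqintD (iF j pj) IH.
Qed.

Section Vectors.
Context (I : finType).
Implicit Types v : T -> I -> R.

Definition sqintv v := forall k, sqint (fun w => v w k).
Definition Exv v : I -> R := fun k => Ex (fun w => v w k).

Lemma measurable_l2 v : (forall k, measurable_fun setT (fun w => v w k)) ->
  measurable_fun setT (fun w => l2 (v w)).
Proof.
move=> mv.
have ms : measurable_fun [set: R] (@Num.sqrt R).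
  by apply: (@continuous_measurable_fun R); exact: sqrt_continuous.
apply: (measurableT_comp ms).
by apply: measurable_sum => k; exact: measurable_funX.
Qed.

Lemma sqintv_l2 v : sqintv v -> sqint (fun w => l2 (v w)).
Proof.
move=> sv.
apply: sqint_le (integ_sum (p := xpredT) (fun k _ => (sv k).2)).
  by apply: measurable_l2 => k; case: (sv k).
by move=> w; rewrite l2_sq.
Qed.

Lemma sqintv_le v (g : T -> R) :
  (forall k, measurable_fun setT (fun w => v w k)) ->
  (forall w, l2 (v w) <= g w) -> sqint g -> sqintv v.
Proof.
move=> mv vg [_ g2] k; apply: sqint_le g2 => // w.
rewrite -(real_normK (num_real (v w k))) lerXn2r ?nnegrE//.
  exact: le_trans (l2_ge0 _) (vg w).
exact: le_trans (l2_coord _ _) (vg w).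
Qed.

(** Jensen's inequality for the norm: pair the mean vector with itself, take the
    pairing inside the expectation and apply Cauchy-Schwarz there. *)
Lemma l2_Exv v : (forall k, integ (fun w => v w k)) ->
  integ (fun w => l2 (v w)) -> l2 (Exv v) <= Ex (fun w => l2 (v w)).
Proof.
move=> iv il; have [->|n0] := eqVneq (l2 (Exv v)) 0.
  by apply: Ex_ge0 => w; exact: l2_ge0.
have lt0 : 0 < l2 (Exv v) by rewrite lt0r n0 l2_ge0.
rewrite -(ler_pM2l lt0) -expr2 l2_sq.
under eq_bigr do rewrite expr2.
rewrite -ExZ//.
have -> : \sum_i Exv v i * Exv v i = Ex (fun w => \sum_i Exv v i * v w i).
  rewrite Ex_sum => [|i _]; last exact: integZ.
  by apply: eq_bigr => i _; rewrite ExZ.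
apply: le_Ex => [||w]; last exact: CauchySchwarz.
- by apply: integ_sum => i _; exact: integZ.
- exact: integZ.
Qed.

End Vectors.
End Expect.

(** * One step of a perturbed Runge-Kutta scheme *)

(** The step is abstracted from the two schemes. The families e and e' are the
    errors before and after the step, delta i is the error of the argument of
    stage i, and kappa i the error of its slope. The slope error is split as
    phi i + (kappa i - phi i), where phi i is the difference of the exact slopes
    and the rest is a Monte Carlo error at the random argument, and as
    xi i + (kappa i - xi i), where xi i is the Monte Carlo error at the
    deterministic argument and the rest is Lipschitz in delta i.

    Both delta and kappa occur on the right of the other one. As h * A is at
    most 1/11, solving for them costs a factor 1 / (1 - h A) <= 11/10. *)
Section Step.
Context d (T : measurableType d) (R : realType) (P : probability T R).
Context (I : finType) (s : nat).
Variables (h Rb L : R) (a : 'I_s -> 'I_s -> R) (b : 'I_s -> R).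
Variables (e e' : T -> I -> R) (delta kappa phi xi : 'I_s -> T -> I -> R).

Let A := s%:R * Rb * L.

Hypotheses (h_ge0 : 0 <= h) (h_le1 : h <= 1) (L_ge0 : 0 <= L) (Rb_ge0 : 0 <= Rb).
Hypothesis hA : h * A <= 11^-1.
Hypothesis aR : forall i j : 'I_s, (j < i)%N -> `|a i j| <= Rb.
Hypothesis bR : forall i, `|b i| <= Rb.
Hypothesis deltaE : forall i w k,
  delta i w k = e w k + h * \sum_(j < s | (j < i)%N) a i j * kappa j w k.
Hypothesis e'E : forall w k, e' w k = e w k + h * \sum_i b i * kappa i w k.
Hypothesis phi_lip : forall i w, l2 (phi i w) <= L * l2 (delta i w).

Let A_ge0 : 0 <= A.
Proof. by rewrite !mulr_ge0. Qed.

Section Pathwise.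
Hypothesis kappa_lip : forall i w,
  l2 (fun k => kappa i w k - xi i w k) <= L * l2 (delta i w).
Let K w := \sum_i l2 (kappa i w).
Let Z w := \sum_i l2 (xi i w).

Let K_ge0 w : 0 <= K w.
Proof. by apply: sumr_ge0 => i _; exact: l2_ge0. Qed.
Let Z_ge0 w : 0 <= Z w.
Proof. by apply: sumr_ge0 => i _; exact: l2_ge0. Qed.

Lemma delta_le_K i w : l2 (delta i w) <= l2 (e w) + h * Rb * K w.
Proof.
rewrite (eq_l2 (deltaE i w)); apply: le_trans (l2D _ _) _.
rewrite lerD2l l2Z ger0_norm// -mulrA ler_wpM2l//.
apply: le_trans (l2_sum _ _) _; rewrite mulr_sumr big_mkcond/=.
apply: ler_sum => j _; case: ifP => ji; rewrite ?mulr_ge0 ?l2_ge0//.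
by rewrite l2Z ler_wpM2r ?l2_ge0// aR.
Qed.

Lemma kappa_le i w : l2 (kappa i w) <= L * l2 (delta i w) + l2 (xi i w).
Proof.
apply: le_trans (_ : l2 (fun k => (kappa i w k - xi i w k) + xi i w k) <= _).
  by under [leRHS]eq_l2 do rewrite subrK.
by apply: le_trans (l2D _ _) _; rewrite lerD2r.
Qed.

Lemma K_le w : K w <= 11 / 10 * (s%:R * L * l2 (e w) + Z w).
Proof.
have h1 : K w <= \sum_(i < s) (L * (l2 (e w) + h * Rb * K w) + l2 (xi i w)).
  apply: ler_sum => i _; apply: le_trans (kappa_le i w) _.
  by rewrite lerD2r ler_wpM2l// delta_le_K.
have h2 : K w <= s%:R * L * l2 (e w) + h * A * K w + Z w.
  apply: le_trans h1 _; rewrite big_split/= sumr_const card_ord -mulr_natl.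
  by rewrite le_eqVlt /A /Z; apply/orP; left; apply/eqP; ring.
have h3 : h * A * K w <= 11^-1 * K w by rewrite ler_wpM2r.
by lra.
Qed.

(** The same factor works again because 1 + (11/10) h A <= 11/10. *)
Lemma delta_le i w : l2 (delta i w) <= 11 / 10 * (l2 (e w) + h * Rb * Z w).
Proof.
apply: le_trans (delta_le_K i w) _.
have h1 : h * Rb * K w <= h * Rb * (11 / 10 * (s%:R * L * l2 (e w) + Z w)).
  by rewrite ler_wpM2l ?mulr_ge0// K_le.
have h2 : h * A * l2 (e w) <= 11^-1 * l2 (e w) by rewrite ler_wpM2r ?l2_ge0.
rewrite /A in h2; nra.
Qed.

End Pathwise.

Section MeanSquare.
Variable v : R.
Hypothesis v_ge0 : 0 <= v.
Hypothesis kappa_lip : forall i w,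
  l2 (fun k => kappa i w k - xi i w k) <= L * l2 (delta i w).
Hypothesis m_kappa : forall i k, measurable_fun setT (fun w => kappa i w k).
Hypothesis m_phi : forall i k, measurable_fun setT (fun w => phi i w k).
Hypothesis e_sq : sqintv P e.
Hypothesis xi_sq : forall i, sqintv P (xi i).
Hypothesis xi_var : forall i, Ex P (fun w => l2 (xi i w) ^+ 2) <= v.
Hypothesis orth : forall i k, Ex P (fun w => e w k * (kappa i w k - phi i w k)) = 0.

Let Z w := \sum_i l2 (xi i w).

Let sq_eps : sqint P (fun w => l2 (e w)).
Proof. exact: sqintv_l2. Qed.
Let sq_Z : sqint P Z.
Proof. by apply: sqint_sum => i _; exact: sqintv_l2. Qed.

Let Z_ge0 w : 0 <= Z w.
Proof. by apply: sumr_ge0 => i _; exact: l2_ge0. Qed.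

Lemma kappa_sq i : sqintv P (kappa i).
Proof.
apply: (@sqintv_le _ _ _ _ _ _ (fun w => L * (11 / 10 * (l2 (e w) + h * Rb * Z w)) + Z w)).
- by move=> k; exact: m_kappa.
- move=> w; apply: le_trans (kappa_le kappa_lip _ _) _; apply: lerD.
    by rewrite ler_wpM2l// delta_le.
  by rewrite /Z (bigD1 i)//= lerDl sumr_ge0// => j _; exact: l2_ge0.
- by apply: sqintD => //; do 2 apply: sqintZ; apply: sqintD => //; exact: sqintZ.
Qed.

Lemma delta_sq i : sqintv P (delta i).
Proof.
move=> k; under eq_fun do rewrite deltaE.
apply: sqintD => //; apply: sqintZ; apply: sqint_sum => j _.
by apply: sqintZ; exact: kappa_sq.
Qed.

Lemma phi_sq i : sqintv P (phi i).
Proof.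
apply: (@sqintv_le _ _ _ _ _ _ (fun w => L * l2 (delta i w))) => //.
by apply: sqintZ; exact: sqintv_l2 (delta_sq i).
Qed.

Lemma e'_sq : sqintv P e'.
Proof.
move=> k; under eq_fun do rewrite e'E.
apply: sqintD => //; apply: sqintZ; apply: sqint_sum => j _.
by apply: sqintZ; exact: kappa_sq.
Qed.

(** Cauchy-Schwarz over the stages; one factor s comes from it and the other one
    from the number of stages. *)
Lemma Z_var : Ex P (fun w => Z w ^+ 2) <= s%:R ^+ 2 * v.
Proof.
apply: (@le_trans _ _ (Ex P (fun w => s%:R * \sum_i l2 (xi i w) ^+ 2))).
  apply: le_Ex => [||w]; first by case: sq_Z.
    apply: integZ; apply: integ_sum => i _.
    by case: (sqintv_l2 (xi_sq i)).
  by rewrite -{1}[X in X%:R * _](card_ord s); exact: sqr_sum_le.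
have ix i : integ P (fun w => l2 (xi i w) ^+ 2) by case: (sqintv_l2 (xi_sq i)).
rewrite ExZ; last by apply: integ_sum => i _.
rewrite Ex_sum// expr2 -mulrA ler_wpM2l//.
apply: le_trans (ler_sum _ (fun i _ => xi_var i)) _.
by rewrite sumr_const card_ord mulr_natl.
Qed.

(** Expanding the square of e + h S, with S the combination of the slope errors,
    leaves three terms. In the cross term, only the exact slopes survive in mean
    because the Monte Carlo errors are orthogonal to e. They are Lipschitz, so
    this term is 2 h A E|e|^2 up to higher order. The square of h S has the
    expected order h^2, and its noise part is the only source of error. *)
Lemma mean_square_step (beta : R) : h * A ^+ 2 <= 1 ->
  4 + 8 * A ^+ 2 <= beta -> 4 * Rb ^+ 2 * s%:R ^+ 2 <= beta ->
  Ex P (fun w => l2 (e' w) ^+ 2) <=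
    (1 + beta * h) * Ex P (fun w => l2 (e w) ^+ 2) + beta * h ^+ 2 * v.
Proof.
move=> hA2 b1 b2.
have kphi i k : sqint P (fun w => kappa i w k - phi i w k).
  by apply: sqintB; [exact: kappa_sq|exact: phi_sq].
have orthS : Ex P (fun w =>
    \sum_i b i * \sum_k e w k * (kappa i w k - phi i w k)) = 0.
  rewrite Ex_sum => [|i _]; last first.
    by apply: integZ; apply: integ_sum => k _; exact: sqintM.
  apply: big1 => i _; rewrite ExZ; last by apply: integ_sum => k _; exact: sqintM.
  by rewrite Ex_sum => [|k _]; [rewrite big1 ?mulr0|exact: sqintM].
have iS : integ P (fun w => \sum_i b i * \sum_k e w k * (kappa i w k - phi i w k)).
  by apply: integ_sum => i _; apply: integZ; apply: integ_sum => k _; exact: sqintM.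
have ie' : integ P (fun w => l2 (e' w) ^+ 2) by case: (sqintv_l2 e'_sq).
have ie : integ P (fun w => l2 (e w) ^+ 2) by case: sq_eps.
have iZ : integ P (fun w => Z w ^+ 2) by case: sq_Z.
(* c1 and c2 collect the pathwise coefficients of |e|^2 and Z^2. The summand 1
   in the parenthesis of c1 pays for the product of |e| and Z by Young's
   inequality with weights h and h^3. *)
pose c1 := 1 + h * (11 / 5 * A + 1 + 121 / 50 * A ^+ 2 * h).
pose c2 := h ^+ 2 * Rb ^+ 2 * (121 / 50 + 121 / 100 * (h * A ^+ 2)).
have pw w : l2 (e' w) ^+ 2 <= c1 * l2 (e w) ^+ 2 + c2 * Z w ^+ 2 +
    2 * h * \sum_i b i * \sum_k e w k * (kappa i w k - phi i w k).
  set eps := l2 (e w).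
  have eps0 : 0 <= eps by exact: l2_ge0.
  pose S k := \sum_i b i * kappa i w k.
  have -> : l2 (e' w) ^+ 2 = eps ^+ 2 + 2 * h * (\sum_k e w k * S k) +
      h ^+ 2 * l2 S ^+ 2.
    rewrite /eps !l2_sq !mulr_sumr -!big_split/=; apply: eq_bigr => k _.
    by rewrite e'E -/(S k); ring.
  have -> : \sum_k e w k * S k =
      \sum_i b i * \sum_k e w k * (kappa i w k - phi i w k) +
      \sum_i b i * \sum_k e w k * phi i w k.
    rewrite -big_split/=; under [RHS]eq_bigr do rewrite -mulrDr -big_split/=.
    under [RHS]eq_bigr do rewrite mulr_sumr.
    rewrite exchange_big/=; apply: eq_bigr => k _; rewrite /S mulr_sumr.
    by apply: eq_bigr => i _; ring.
  (* Cauchy-Schwarz and the Lipschitz bound, stage by stage. *)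
  have cross : \sum_i b i * \sum_k e w k * phi i w k <=
      A * eps * (11 / 10 * (eps + h * Rb * Z w)).
    have -> : A * eps * (11 / 10 * (eps + h * Rb * Z w)) =
        \sum_(i < s) Rb * (eps * (L * (11 / 10 * (eps + h * Rb * Z w)))).
      by rewrite sumr_const card_ord -[RHS]mulr_natl /A; ring.
    apply: ler_sum => i _; apply: le_trans (ler_norm _) _; rewrite normrM.
    apply: ler_pM => //.
    have ph : l2 (phi i w) <= L * (11 / 10 * (eps + h * Rb * Z w)).
      by apply: le_trans (phi_lip i w) _; rewrite ler_wpM2l// delta_le.
    apply: (@le_trans _ _ (eps * l2 (phi i w))); last by rewrite ler_wpM2l.
    rewrite ler_norml CauchySchwarz andbT lerNl -sumrN.
    under eq_bigr do rewrite -mulrN.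
    by rewrite -[l2 (phi i w)]l2N CauchySchwarz.
  have SK : l2 S <= Rb * (11 / 10 * (s%:R * L * eps + Z w)).
    apply: le_trans (l2_sum _ _) _.
    apply: le_trans (_ : Rb * (\sum_i l2 (kappa i w)) <= _).
      by rewrite mulr_sumr ler_sum// => i _; rewrite l2Z ler_wpM2r ?l2_ge0.
    by rewrite ler_wpM2l// K_le.
  have SK2 : l2 S ^+ 2 <= (Rb * (11 / 10 * (s%:R * L * eps + Z w))) ^+ 2.
    by rewrite lerXn2r ?nnegrE ?l2_ge0// (le_trans (l2_ge0 _) SK).
  have SK3 : (Rb * (11 / 10 * (s%:R * L * eps + Z w))) ^+ 2 <=
      121 / 50 * (A ^+ 2 * eps ^+ 2 + Rb ^+ 2 * Z w ^+ 2).
    have -> : Rb * (11 / 10 * (s%:R * L * eps + Z w)) =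
        11 / 10 * (A * eps + Rb * Z w) by rewrite /A; ring.
    by have := sqr_ge0 (A * eps - Rb * Z w); nra.
  have h2 : 0 <= h ^+ 2 by exact: sqr_ge0.
  have := ler_wpM2l h2 (le_trans SK2 SK3).
  have := ler_wpM2l (mulr_ge0 (ler0n R 2) h_ge0) cross.
  have := mulr_ge0 h_ge0 (sqr_ge0 (eps - 11 / 10 * h * A * Rb * Z w)).
  rewrite /c1 /c2; set X := \sum_i _; lra.
have stepE : Ex P (fun w => l2 (e' w) ^+ 2) <=
    c1 * Ex P (fun w => l2 (e w) ^+ 2) + c2 * Ex P (fun w => Z w ^+ 2).
  apply: le_trans (le_Ex ie' _ pw) _.
    by apply: integD; [apply: integD; exact: integZ|exact: integZ].
  rewrite ExD; [|by apply: integD; exact: integZ|exact: integZ].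
  rewrite ExD; [|exact: integZ..].
  by rewrite !ExZ// orthS mulr0 addr0.
apply: le_trans stepE _; apply: lerD.
  rewrite ler_wpM2r//; first by apply: Ex_ge0 => w; exact: sqr_ge0.
  rewrite /c1 lerD2l mulrC ler_wpM2r//.
  have := sqr_ge0 (A - 1).
  have : A ^+ 2 * h <= A ^+ 2 by rewrite ler_piMr ?sqr_ge0.
  have := sqr_ge0 A.
  by nra.
have c20 : 0 <= c2.
  by rewrite /c2 mulr_ge0 ?mulr_ge0 ?sqr_ge0// addr_ge0 ?mulr_ge0 ?sqr_ge0.
apply: le_trans (ler_wpM2l c20 Z_var) _.
have : c2 <= 4 * (h ^+ 2 * Rb ^+ 2).
  rewrite /c2 mulrC ler_wpM2r ?mulr_ge0 ?sqr_ge0//; lra.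
move=> /(ler_wpM2r (mulr_ge0 (sqr_ge0 s%:R) v_ge0)) /le_trans; apply.
have := ler_wpM2r (mulr_ge0 (sqr_ge0 h) v_ge0) b2; lra.
Qed.

(** The constant is 2 (11/10)^2. *)
Lemma delta_mean_square i : Ex P (fun w => l2 (delta i w) ^+ 2) <=
  121 / 50 * (Ex P (fun w => l2 (e w) ^+ 2) + h ^+ 2 * Rb ^+ 2 * s%:R ^+ 2 * v).
Proof.
have ie : integ P (fun w => l2 (e w) ^+ 2) by case: sq_eps.
have iZ : integ P (fun w => Z w ^+ 2) by case: sq_Z.
have hRZ : 0 <= h ^+ 2 * Rb ^+ 2 by rewrite mulr_ge0 ?sqr_ge0.
apply: (@le_trans _ _ (Ex P (fun w =>
    121 / 50 * (l2 (e w) ^+ 2 + h ^+ 2 * Rb ^+ 2 * Z w ^+ 2)))).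
  apply: le_Ex => [||w].
  - by case: (sqintv_l2 (delta_sq i)).
  - by apply: integZ; apply: integD => //; exact: integZ.
  have d2 : l2 (delta i w) ^+ 2 <= (11 / 10 * (l2 (e w) + h * Rb * Z w)) ^+ 2.
    rewrite lerXn2r ?nnegrE ?l2_ge0// ?delta_le//.
    by apply: le_trans (delta_le kappa_lip i w); exact: l2_ge0.
  apply: le_trans d2 _.
  by have := sqr_ge0 (l2 (e w) - h * Rb * Z w); nra.
rewrite ExZ; last by apply: integD => //; exact: integZ.
rewrite ExD//; last exact: integZ.
rewrite ExZ// ler_wpM2l// lerD2l -[leRHS]mulrA ler_wpM2l//.
exact: Z_var.
Qed.

Section Bias.
Variables (M : R) (D : 'I_s -> I -> I -> R).
Hypothesis M_ge0 : 0 <= M.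
Hypothesis D_lip : forall i (x : I -> R),
  l2 (fun k => \sum_j D i k j * x j) <= L * l2 x.
Hypothesis phi_taylor : forall i w,
  l2 (fun k => phi i w k - \sum_j D i k j * delta i w j) <=
  M * l2 (delta i w) ^+ 2.
Hypothesis mean_kappa : forall i k,
  Ex P (fun w => kappa i w k) = Ex P (fun w => phi i w k).

(** In mean, kappa i equals phi i, and phi i is D i applied to the mean of
    delta i up to a remainder of the order of the mean square of delta i. So the
    mean errors satisfy the relations of the stages with a linear slope, and the
    remainder appears with the factor (11/10) (121/50) < 27/10. *)
Lemma bias_step (alpha : R) :
  11 / 10 * A <= alpha -> 27 / 10 * (s%:R * Rb * M) <= alpha ->
  27 / 10 * (s%:R * Rb * M) * (s%:R ^+ 2 * Rb ^+ 2) <= alpha ->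
  l2 (Exv P e') <= (1 + alpha * h) * l2 (Exv P e) +
    alpha * h * (Ex P (fun w => l2 (e w) ^+ 2) + h ^+ 2 * v).
Proof.
move=> al1 al2 al3.
set B := l2 (Exv P e); set Ee2 := Ex P _.
have B0 : 0 <= B by exact: l2_ge0.
have Ee20 : 0 <= Ee2 by apply: Ex_ge0 => w; exact: sqr_ge0.
have ik i k : integ P (fun w => kappa i w k) by apply/sqint_integ/kappa_sq.
have ip i k : integ P (fun w => phi i w k) by apply/sqint_integ/phi_sq.
have id i k : integ P (fun w => delta i w k) by apply/sqint_integ/delta_sq.
have ie k : integ P (fun w => e w k) by apply/sqint_integ/e_sq.
pose Phi := \sum_i l2 (Exv P (phi i)).
have Phi0 : 0 <= Phi by apply: sumr_ge0 => i _; exact: l2_ge0.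
pose Q := 121 / 50 * (Ee2 + h ^+ 2 * Rb ^+ 2 * s%:R ^+ 2 * v).
have Ed i : l2 (Exv P (delta i)) <= B + h * Rb * Phi.
  have Edk k : Exv P (delta i) k =
      Exv P e k + h * \sum_(j < s | (j < i)%N) a i j * Exv P (phi j) k.
    rewrite /Exv; under eq_fun do rewrite deltaE.
    rewrite ExD//; last first.
      by apply: integZ; apply: integ_sum => j _; exact: integZ.
    congr (_ + _); rewrite ExZ; last by apply: integ_sum => j _; exact: integZ.
    congr (_ * _); rewrite Ex_sum => [|j _]; last exact: integZ.
    by apply: eq_bigr => j _; rewrite ExZ// mean_kappa.
  rewrite (eq_l2 Edk); apply: le_trans (l2D _ _) _; rewrite lerD2l l2Z ger0_norm//.
  rewrite -mulrA ler_wpM2l//; apply: le_trans (l2_sum _ _) _.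
  rewrite mulr_sumr big_mkcond/=; apply: ler_sum => j _.
  case: ifP => ji; rewrite ?mulr_ge0 ?l2_ge0//.
  by rewrite l2Z ler_wpM2r ?l2_ge0// aR.
have Ep i : l2 (Exv P (phi i)) <= L * (B + h * Rb * Phi) + M * Q.
  pose lin w k := \sum_j D i k j * delta i w j.
  have ilin k : integ P (fun w => lin w k).
    by apply: integ_sum => j _; exact: integZ.
  have irho k : integ P (fun w => phi i w k - lin w k) by exact: integB.
  have id2 : integ P (fun w => M * l2 (delta i w) ^+ 2).
    by apply: integZ; case: (sqintv_l2 (delta_sq i)).
  have ilrho : integ P (fun w => l2 (fun k => phi i w k - lin w k)).
    apply: integ_le id2 => [|w]; last by rewrite ger0_norm ?l2_ge0// phi_taylor.
    by apply: measurable_l2 => k; exact: integ_meas.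
  have -> : l2 (Exv P (phi i)) = l2 (fun k =>
      (\sum_j D i k j * Exv P (delta i) j) +
      Exv P (fun w k => phi i w k - lin w k) k).
    apply: eq_l2 => k.
    have -> : Exv P (fun w k => phi i w k - lin w k) k =
        Exv P (phi i) k - \sum_j D i k j * Exv P (delta i) j.
      rewrite /Exv ExB//; congr (_ - _); rewrite /lin Ex_sum => [|j _].
        by apply: eq_bigr => j _; rewrite ExZ.
      exact: integZ.
    by rewrite addrC subrK.
  apply: le_trans (l2D _ _) _; apply: lerD.
    by apply: le_trans (D_lip i _) _; rewrite ler_wpM2l.
  apply: le_trans (l2_Exv irho ilrho) _.
  apply: le_trans (le_Ex ilrho id2 (phi_taylor i)) _.
  rewrite ExZ; last by case: (sqintv_l2 (delta_sq i)).
  by rewrite ler_wpM2l// delta_mean_square.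
have PhiB : Phi <= 11 / 10 * (s%:R * L * B + s%:R * M * Q).
  have h1 : Phi <= s%:R * (L * (B + h * Rb * Phi) + M * Q).
    rewrite mulr_natl -[X in _ *+ X](card_ord s) -sumr_const.
    by apply: ler_sum => i _; exact: Ep.
  have h2 : h * A * Phi <= 11^-1 * Phi by rewrite ler_wpM2r.
  rewrite /A in h2; lra.
have Be' : l2 (Exv P e') <= B + h * Rb * Phi.
  have Ek k : Exv P e' k = Exv P e k + h * \sum_i b i * Exv P (phi i) k.
    rewrite /Exv; under eq_fun do rewrite e'E.
    rewrite ExD//; last first.
      by apply: integZ; apply: integ_sum => j _; exact: integZ.
    congr (_ + _); rewrite ExZ; last by apply: integ_sum => j _; exact: integZ.
    congr (_ * _); rewrite Ex_sum => [|j _]; last exact: integZ.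
    by apply: eq_bigr => j _; rewrite ExZ// mean_kappa.
  rewrite (eq_l2 Ek); apply: le_trans (l2D _ _) _; rewrite lerD2l l2Z ger0_norm//.
  rewrite -mulrA ler_wpM2l//; apply: le_trans (l2_sum _ _) _.
  by rewrite mulr_sumr; apply: ler_sum => j _; rewrite l2Z ler_wpM2r ?l2_ge0.
apply: le_trans Be' _.
have h1 : h * Rb * Phi <= h * Rb * (11 / 10 * (s%:R * L * B + s%:R * M * Q)).
  by rewrite ler_wpM2l ?mulr_ge0.
have h2 : h * B * (11 / 10 * A) <= h * B * alpha.
  by rewrite ler_wpM2l ?mulr_ge0.
have h3 : h * Ee2 * (27 / 10 * (s%:R * Rb * M)) <= h * Ee2 * alpha.
  by rewrite ler_wpM2l ?mulr_ge0.
have h4 : h * (h ^+ 2 * v) * (27 / 10 * (s%:R * Rb * M) * (s%:R ^+ 2 * Rb ^+ 2)) <=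
    h * (h ^+ 2 * v) * alpha.
  by rewrite ler_wpM2l ?mulr_ge0 ?sqr_ge0.
have h5 : 0 <= h * Ee2 * (s%:R * Rb * M) by rewrite !mulr_ge0.
have h6 : 0 <= h * (h ^+ 2 * v) * (s%:R * Rb * M) * (s%:R ^+ 2 * Rb ^+ 2).
  by rewrite !mulr_ge0 ?sqr_ge0.
rewrite /Q /A in h1 h2 *; lra.
Qed.

End Bias.

End MeanSquare.
End Step.

(** * Discrete Gronwall estimates *)

(** V stands for the mean square error and B for the norm of the bias. *)
Section Gronwall.
Context (R : realType) (N : nat) (h alpha beta v : R) (V B : nat -> R).
Hypotheses (h_ge0 : 0 <= h) (v_ge0 : 0 <= v) (alpha_ge0 : 0 <= alpha).
Hypotheses (beta_ge0 : 0 <= beta).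
Hypotheses (V0 : V 0 = 0) (B0 : B 0 = 0).
Hypothesis V_step : forall n, (n < N)%N ->
  V n.+1 <= (1 + beta * h) * V n + beta * h ^+ 2 * v.
Hypothesis B_step : forall n, (n < N)%N ->
  B n.+1 <= (1 + alpha * h) * B n + alpha * h * (V n + h ^+ 2 * v).

Lemma pow_le_expR (c : R) n : 0 <= c -> (1 + c * h) ^+ n <= expR (c * (n%:R * h)).
Proof.
move=> c0; have -> : c * (n%:R * h) = n%:R * (c * h) by ring.
rewrite expRM_natl.
by rewrite lerXn2r ?nnegrE ?expR_ge0 ?addr_ge0 ?mulr_ge0// expR_ge1Dx.
Qed.

Let V_le n : (n <= N)%N -> V n <= ((1 + beta * h) ^+ n - 1) * (h * v).
Proof.
elim: n => [|n IH] nN; first by rewrite V0 expr0 subrr mul0r.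
apply: le_trans (V_step nN) _.
have b0 : 0 <= 1 + beta * h by rewrite addr_ge0 ?mulr_ge0.
have := ler_wpM2l b0 (IH (ltnW nN)).
by rewrite [_ ^+ n.+1]exprS; lra.
Qed.

Lemma mean_square_gronwall : V N <= (expR (beta * (N%:R * h)) - 1) * (h * v).
Proof.
apply: le_trans (V_le (leqnn N)) _.
by rewrite ler_wpM2r ?mulr_ge0// lerD2r pow_le_expR.
Qed.

Let B_le n : (n <= N)%N ->
  B n <= ((1 + alpha * h) ^+ n - 1) * (h ^+ 2 * v) +
    alpha * (n%:R * h) * ((1 + Num.max alpha beta * h) ^+ n - 1) * (h * v).
Proof.
set gamma := Num.max alpha beta.
have ag : alpha * h <= gamma * h by rewrite ler_wpM2r// le_max lexx.
have bg : beta * h <= gamma * h by rewrite ler_wpM2r// le_max lexx orbT.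
have ah0 : 0 <= alpha * h by rewrite mulr_ge0.
have gh0 : 0 <= gamma * h by apply: le_trans ag.
elim: n => [|n IH] nN; first by rewrite B0 !expr0 !subrr !(mul0r, mulr0) addr0.
apply: le_trans (B_step nN) _.
have a0 : 0 <= 1 + alpha * h by rewrite addr_ge0.
have b0 : 0 <= 1 + beta * h by rewrite addr_ge0 ?mulr_ge0.
have := ler_wpM2l a0 (IH (ltnW nN)).
have := ler_wpM2l ah0 (V_le (ltnW nN)).
set X := (1 + alpha * h) ^+ n; set G := (1 + gamma * h) ^+ n.
have XG : (1 + beta * h) ^+ n <= G.
  by rewrite lerXn2r ?nnegrE ?lerD2l// addr_ge0.
have G1 : 1 <= G by rewrite exprn_ege1// lerDl.
set Y := (1 + beta * h) ^+ n in XG *.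
rewrite [(1 + alpha * h) ^+ n.+1]exprS [(1 + gamma * h) ^+ n.+1]exprS -/X -/G -[n.+1%:R]natr1 => h1 h2.
have hv : 0 <= h * v by rewrite mulr_ge0.
(* Both the old contribution of V and the new one fit into the next power of
   1 + gamma * h, so each step adds one more multiple of alpha * h. *)
have k1 : (Y - 1) <= (1 + gamma * h) * G - 1.
  by rewrite lerD2r (le_trans XG)// ler_peMl ?lerDl// (le_trans ler01 G1).
have k2 : (1 + alpha * h) * (G - 1) <= (1 + gamma * h) * G - 1.
  have : (1 + alpha * h) * (G - 1) <= (1 + gamma * h) * (G - 1).
    by rewrite ler_wpM2r ?subr_ge0// lerD2l.
  lra.
have ahv : 0 <= alpha * h * (h * v) by rewrite mulr_ge0.
have := ler_wpM2l ahv k1.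
have nahv : 0 <= n%:R * (alpha * h * (h * v)) by rewrite mulr_ge0.
have := ler_wpM2l nahv k2.
lra.
Qed.

Lemma bias_gronwall :
  B N <= (expR (alpha * (N%:R * h)) - 1) * (h ^+ 2 * v) +
    alpha * (N%:R * h) * (expR (Num.max alpha beta * (N%:R * h)) - 1) * (h * v).
Proof.
apply: le_trans (B_le (leqnn N)) _; apply: lerD.
  by rewrite ler_wpM2r ?mulr_ge0 ?sqr_ge0// lerD2r pow_le_expR.
rewrite ler_wpM2r ?mulr_ge0// ler_wpM2l ?mulr_ge0// lerD2r pow_le_expR//.
by rewrite le_max alpha_ge0.
Qed.

End Gronwall.

(** * Derivatives along lines and gradients *)

(** Directional derivatives are reduced to derivatives of functions of one real
    variable: phi restricted to a line has the same difference quotients. *)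
Section LineDerivative.
Context (R : realType) (V : normedModType R).
Implicit Types (phi : V -> R) (x v w : V).

Lemma line_quotient phi x v (t : R) :
  (fun r : R => r^-1 *: (((fun t => phi (x + t *: v)) \o shift t) (r *: 1) -
     phi (x + t *: v))) =
  (fun r : R => r^-1 *: ((phi \o shift (x + t *: v)) (r *: v) - phi (x + t *: v))).
Proof.
apply/funext => r /=; congr (_ *: (phi _ - _)).
by rewrite /shift/= [r *: 1]mulr1 scalerDl addrCA.
Qed.

Lemma is_derive_line phi x v (t : R) : derivable phi (x + t *: v) v ->
  is_derive t 1 (fun t => phi (x + t *: v)) ('D_v phi (x + t *: v)).
Proof.
move=> dphi; split; first by rewrite /derivable line_quotient.
by rewrite /derive line_quotient.
Qed.

Lemma mean_value_line phi x v : (forall y, derivable phi y v) ->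
  exists2 c : R, 0 <= c <= 1 & phi (x + v) - phi x = 'D_v phi (x + c *: v).
Proof.
move=> dphi.
have dl (t : R) : is_derive t 1 (fun t => phi (x + t *: v)) ('D_v phi (x + t *: v)).
  exact: is_derive_line.
have cl : {within `[0, 1], continuous (fun t : R => phi (x + t *: v))}.
  apply: continuous_subspaceT => t; apply: differentiable_continuous.
  by apply/derivable1_diffP; case: (dl t).
have [c] := @MVT_segment R _ _ 0 1 ler01 (fun t _ => dl t) cl.
rewrite in_itv/= scale1r scale0r addr0 subr0 mulr1 => c01 E.
by exists c.
Qed.

Lemma deriveZv phi x v (a : R) : derivable phi x v ->
  derivable phi x (a *: v) /\ 'D_(a *: v) phi x = a * 'D_v phi x.
Proof.
move=> dphi.
have dl : is_derive (0 : R) 1 (fun t => phi (x + t *: v)) ('D_v phi x).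
  by have := @is_derive_line phi x v 0; rewrite scale0r addr0; apply.
have dm : is_derive (0 : R) 1 (fun t : R => a * t) a.
  by apply: is_derive_eq; rewrite /GRing.scale/=; ring.
have dl' : is_derive (a * 0) 1 (fun t : R => phi (x + t *: v)) ('D_v phi x).
  by rewrite mulr0.
have [dc cE] := @is_derive1_comp _ (fun t => phi (x + t *: v)) (fun t : R => a * t) 0 _ _ dl' dm.
have E := @line_quotient phi x (a *: v) 0.
have F : (fun t : R => phi (x + t *: v)) \o (fun t : R => a * t) =
    (fun t : R => phi (x + t *: (a *: v))).
  by apply/funext => t /=; rewrite scalerA mulrC.
rewrite F in dc cE.
move: dc cE; rewrite /derivable /derive E !scale0r !addr0 => dc cE.
by split => //; rewrite [LHS]cE mulrC.
Qed.

(** Go from x to x + t (v + w) by way of x + t v. By the mean value theorem, the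
    second leg contributes the derivative in the direction w at a point close to
    x, which converges because this derivative is continuous. *)
Lemma deriveDv phi x v w :
  (forall y u, derivable phi y u) -> (forall u, continuous ('D_u phi)) ->
  'D_(v + w) phi x = 'D_v phi x + 'D_w phi x.
Proof.
move=> dphi cphi; apply/cvg_lim => //.
have dv : (fun r : R => r^-1 *: ((phi \o shift x) (r *: v) - phi x)) @ 0^' --> 'D_v phi x.
  exact: dphi x v.
have dw : (fun r : R => r^-1 *: ((phi \o shift x) (r *: (v + w)) - 
   (phi \o shift x) (r *: v))) @ 0^' --> 'D_w phi x.
  apply/cvgrPdist_le => e e0.
  have /cvgrPdist_le /(_ e e0) := cphi w x.
  move=> /nbhs_ballP[r /= r0 rD].
  pose C := `|v| + `|w| + 1.
  have C0 : 0 < C by rewrite ltr_wpDl// addr_ge0.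
  near=> t.
  have tn0 : t != 0 by near: t; exact: nbhs_dnbhs_neq.
  have [c c01 /=] := @mean_value_line phi (x + t *: v) (t *: w) (fun y => dphi y _).
  rewrite (deriveZv _ (dphi _ _)).2 => E.
  rewrite (_ : t *: (v + w) + x = x + t *: v + t *: w); last first.
    by rewrite scalerDr addrC addrA.
  rewrite [t *: v + x]addrC E [_^-1 *: _]mulrA mulVf// mul1r.
  apply: rD; rewrite -ball_normE /ball_/=.
  (* The intermediate point is at distance at most |t| (|v| + |w|) from x. *)
  rewrite -addrA opprD addNKr normrN.
  have tC : `|t| * C < r.
    rewrite -ltr_pdivlMr//; near: t; have rC := divr_gt0 r0 C0; exact: dnbhs0_lt.
  apply: le_lt_trans tC; rewrite scalerA -[c * t]mulrC -scalerA -scalerDr normrZ.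
  rewrite ler_wpM2l// /C; apply: le_trans (ler_normD _ _) _.
  rewrite -addrA lerD2l normrZ ger0_norm; last by case/andP: c01.
  rewrite ler_wpDr// ler_piMl//; by case/andP: c01.
apply: cvg_trans (cvgD dv dw); apply: near_eq_cvg.
near=> t; rewrite -[LHS]scalerDr/=; congr (_ *: _).
by rewrite addrC addrA subrK.
Unshelve. all: by end_near.
Qed.

End LineDerivative.

Section Gradient.
Context (R : realType) (n : nat).
Implicit Types (phi : 'rV[R]_n -> R) (x v : 'rV[R]_n).

(** What remains of differentiability for estimates along segments. It follows
    from differentiability, which is known for g, and from continuity of the
    directional derivatives, which is known for f. *)
Definition grad_derivable phi := forall x v,
  derivable phi x v /\ 'D_v phi x = \sum_j v 0 j * partial j phi x.

Lemma differentiable_grad_derivable phi :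
  (forall x, differentiable phi x) -> grad_derivable phi.
Proof.
move=> dphi x v; split; first exact: diff_derivable.
rewrite deriveE// {1}[v]row_sum_delta linear_sum; apply: eq_bigr => j _.
by rewrite linearZ /partial deriveE.
Qed.

Lemma C1_grad_derivable phi :
  (forall x v, derivable phi x v) -> (forall v, continuous ('D_v phi)) ->
  grad_derivable phi.
Proof.
move=> dphi cphi x v; split=> //.
rewrite {1}[v]row_sum_delta.
elim/big_rec2: _ => [|j y w _ <-].
  have := (deriveZv 0 (dphi x 0)).2; rewrite scale0r mul0r; exact.
by rewrite deriveDv// (deriveZv _ (dphi _ _)).2.
Qed.

Lemma norm_CauchySchwarz (I : finType) (u w : I -> R) :
  `|\sum_i u i * w i| <= l2 u * l2 w.
Proof.
rewrite ler_norml CauchySchwarz andbT lerNl -sumrN -(l2N w).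
by under eq_bigr do rewrite -mulrN; exact: CauchySchwarz.
Qed.

Lemma grad_derivable_lipschitz phi (M : R) : grad_derivable phi ->
  (forall x, l2 (fun j => partial j phi x) <= M) ->
  forall x y, `|phi y - phi x| <= M * l2 (fun j => y 0 j - x 0 j).
Proof.
move=> gphi phiM x y.
have [c _] := @mean_value_line _ _ phi x (y - x) (fun z => (gphi z _).1).
rewrite [x + _]addrC subrK (gphi _ _).2 => ->.
have -> : (fun j => y 0 j - x 0 j) = (fun j => (y - x) 0 j).
  by apply/funext => j; rewrite !mxE.
set z := x + _.
apply: (@le_trans _ _ (l2 (fun j => partial j phi z) * l2 (fun j => (y - x) 0 j))).
  rewrite [leRHS]mulrC. exact: norm_CauchySchwarz.
by rewrite ler_wpM2r ?l2_ge0.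
Qed.

(** Apply the mean value theorem to phi, and then to the directional derivative
    of phi in the same direction; this is why the factor 1/2 of Taylor's formula
    is lost. The Frobenius norm of the Hessian appears through
    Cauchy-Schwarz on pairs of indices, since the matrix v_k v_j has Frobenius
    norm |v|^2. *)
Lemma grad_derivable_taylor phi (M : R) : grad_derivable phi ->
  (forall k, grad_derivable (partial k phi)) ->
  (forall x, Num.sqrt (\sum_j \sum_k partial j (partial k phi) x ^+ 2) <= M) ->
  forall x y,
    `|phi y - phi x - \sum_j (y 0 j - x 0 j) * partial j phi x| <=
    M * l2 (fun j => y 0 j - x 0 j) ^+ 2.
Proof.
move=> gphi gphi2 phiM x y.
set v := y - x.
have vE j : y 0 j - x 0 j = v 0 j by rewrite !mxE.
under eq_bigr do rewrite vE.
rewrite (_ : (fun j => _) = v 0); last by apply/funext => j; rewrite vE.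
have [c c01] := @mean_value_line _ _ phi x v (fun z => (gphi z _).1).
rewrite {1}/v [x + _]addrC subrK (gphi _ _).2 => ->.
pose psi z := \sum_j v 0 j * partial j phi z.
rewrite -/(psi _) -/(psi x).
have dpsi z : is_derive z (c *: v) psi
    (\sum_k v 0 k * \sum_j (c *: v) 0 j * partial j (partial k phi) z).
  rewrite (_ : psi = \sum_k (fun z => v 0 k *: partial k phi z)); last first.
    by apply/funext => u; rewrite fct_sumE.
  apply: is_derive_sum => k; apply: is_deriveZ.
  by rewrite -(gphi2 k z (c *: v)).2; apply/derivableP; case: (gphi2 k z (c *: v)).
have [c' _ ->] := @mean_value_line _ _ psi x (c *: v) (fun z => @ex_derive _ _ _ _ _ _ _ (dpsi z)).
set z := x + _; have [_ ->] := dpsi z.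
have c0 : 0 <= c by case/andP: c01.
have c1 : c <= 1 by case/andP: c01.
have -> : \sum_k v 0 k * (\sum_j (c *: v) 0 j * partial j (partial k phi) z) =
    c * \sum_(p : 'I_n * 'I_n) (v 0 p.2 * v 0 p.1) * partial p.1 (partial p.2 phi) z.
  rewrite -(pair_big xpredT xpredT (fun j k => (v 0 k * v 0 j) * partial j (partial k phi) z))/=.
  rewrite exchange_big/= mulr_sumr; apply: eq_bigr => k _.
  by rewrite !mulr_sumr; apply: eq_bigr => j _; rewrite [(c *: v) 0 j]mxE; ring.
rewrite normrM (ger0_norm c0).
set S := \sum_p _.
apply: (@le_trans _ _ `|S|); first by rewrite ler_piMl.
pose f (p : 'I_n * 'I_n) := v 0 p.2 * v 0 p.1.
pose H (p : 'I_n * 'I_n) := partial p.1 (partial p.2 phi) z.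
have fE : l2 f = l2 (v 0) ^+ 2.
  rewrite /l2 sqr_sqrtr ?sumr_ge0// => [|j _]; last exact: sqr_ge0.
  rewrite -[RHS]ger0_norm ?sumr_ge0// => [|j _]; last exact: sqr_ge0.
  rewrite -sqrtr_sqr; congr Num.sqrt; rewrite expr2 big_distrlr/=.
  rewrite (pair_big xpredT xpredT (fun j k => v 0 j ^+ 2 * v 0 k ^+ 2))/=.
  by apply: eq_bigr => p _; rewrite /f; ring.
have HM : l2 H <= M.
  rewrite /l2 -(pair_big xpredT xpredT (fun j k => (partial j (partial k phi) z) ^+ 2))/=.
  exact: phiM.
rewrite -fE mulrC; apply: (@le_trans _ _ (l2 f * l2 H)); last first.
  by rewrite ler_wpM2l ?l2_ge0.
exact: norm_CauchySchwarz.
Qed.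

End Gradient.

Section Slices.
Context (R : realType) (n : nat).

Lemma Ck_continuous (V W : normedModType R) k (F : V -> W) : Ck k F -> continuous F.
Proof. by case: k => // k []. Qed.

Definition slice (F : R * 'rV[R]_n -> 'rV[R]_n) (t : R) (i : 'I_n) (x : 'rV[R]_n) : R :=
  F (t, x) 0 i.

Lemma continuous_slice F t i : continuous F -> continuous (slice F t i).
Proof.
move=> cF x; apply: (@continuous_comp _ _ _ (fun x => F (t, x)) (fun M : 'rV[R]_n => M 0 i)).
  apply: (@continuous_comp _ _ _ (fun x => (t, x)) F); last exact: cF.
  apply: (@cvg_pair _ _ _ (nbhs x) (nbhs t) (nbhs x)); [exact: cvg_cst|exact: cvg_id].
exact: coord_continuous.
Qed.

Lemma derive_slice F t i x v : derivable F (t, x) (0, v) ->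
  derivable (slice F t i) x v /\
  'D_v (slice F t i) x = slice ('D_(0, v) F) t i x.
Proof.
move=> dF.
have E : (fun h : R => h^-1 *: (((fun y => F y 0 i) \o shift (t, x)) (h *: (0, v)) -
     F (t, x) 0 i)) =
   (fun h : R => h^-1 *: ((slice F t i \o shift x) (h *: v) - slice F t i x)).
  apply/funext => h /=; rewrite /slice; congr (_ *: (F _ 0 i - _)).
  by congr pair; rewrite /= scaler0 add0r.
have d1 : derivable (fun y => F y 0 i) (t, x) (0, v).
  by move/derivable_mxP : dF; apply.
split; first by move: d1; rewrite /derivable E.
by rewrite [in RHS]/slice derive_mx// mxE /derive E.
Qed.

(** At a fixed time, derivatives in u are derivatives of the function of (t, u)
    in directions (0, v). *)
Lemma Ck_slice_grad_derivable (F : R * 'rV[R]_n -> 'rV[R]_n) t i k :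
  @Ck R (R * 'rV[R]_n)%type 'rV[R]_n k.+2 F ->
  let phi := fun x => F (t, x) 0 i in
  grad_derivable phi /\ forall j, grad_derivable (partial j phi).
Proof.
case=> cF dF CF phi.
have Dphi v : 'D_v phi = slice ('D_(0, v) F) t i.
  by apply/funext => x; rewrite (@derive_slice F t i x v (dF _ _)).2.
split.
  apply: C1_grad_derivable => [x v|v]; first exact: (@derive_slice F t i x v (dF _ _)).1.
  by rewrite Dphi; apply: continuous_slice; case: (CF (0, v)).
move=> j; rewrite /partial Dphi.
have [cG dG CG] := CF (0, delta_mx 0 j).
apply: C1_grad_derivable => [x v|v]; first exact: (@derive_slice _ t i x v (dG _ _)).1.
rewrite (_ : 'D_v _ = slice ('D_(0, v) ('D_(0, delta_mx 0 j) F)) t i).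
  by apply: continuous_slice; exact: (@Ck_continuous _ _ k _ (CG (0, v))).
by apply/funext => x; rewrite (@derive_slice _ t i x v (dG _ _)).2.
Qed.

End Slices.

(** * Measurability of Caratheodory functions *)

(** Y is approximated by functions with countably many values, the nodes of the
    grids of mesh 1 / (m + 1). On each cell of the grid F (Y a) a is replaced by
    F y a with y fixed, which is measurable, and continuity gives the limit. *)
Section Caratheodory.
Context d (A : measurableType d) (R : realType) (n : nat).
Variables (F : 'rV[R]_n -> A -> R) (Y : A -> 'rV[R]_n).
Hypothesis mY : forall k, measurable_fun setT (fun a => Y a 0 k).
Hypothesis mF : forall y, measurable_fun setT (F y).
Hypothesis cF : forall a, continuous (F ^~ a).

Let cell (m : nat) (a : A) : 'rV[int]_n := \row_k Num.floor (Y a 0 k * m.+1%:R).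
Let node (m : nat) (z : 'rV[int]_n) : 'rV[R]_n := \row_k ((z 0 k)%:~R / m.+1%:R).

Let measurable_cell m z : measurable [set a | cell m a = z].
Proof.
have -> : [set a | cell m a = z] =
    \bigcap_(k in [set: 'I_n])
      ((fun a => Y a 0 k * m.+1%:R) @^-1` `[(z 0 k)%:~R, (z 0 k + 1)%:~R[%classic).
  apply/seteqP; split => [a /= <- k _|a /= za].
    by rewrite /= in_itv/= mxE floor_le/= floorD1_gt.
  apply/rowP => k; rewrite mxE; apply/eqP.
  by have := za k I; rewrite /= in_itv/= floor_eq.
apply: fin_bigcap_measurable => // k _; rewrite -[X in measurable X]setTI.
by apply: (measurable_funM (mY k) (measurable_cst _)).
Qed.

Let measurable_cells m : measurable_fun setT (fun a => F (node m (cell m a)) a).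
Proof.
move=> _ B mB; rewrite setTI.
have -> : (fun a => F (node m (cell m a)) a) @^-1` B =
    \bigcup_z ([set a | cell m a = z] `&` (F (node m z) @^-1` B)).
  apply/seteqP; split => [a /= Ba|a [z _ [/= <-]]//]; by exists (cell m a).
apply: countable_bigcupT_measurable; first exact: countableP.
move=> z; apply: measurableI => //; rewrite -[X in measurable X]setTI; exact: mF.
Qed.

Let cvg_node a : node m (cell m a) @[m --> \oo] --> Y a.
Proof.
apply/cvgrPdist_le => e e0; near=> m.
rewrite [leLHS]/Num.Def.normr/= mx_normrE (bigmax_le _ (ltW e0))//= => -[i j] _ /=.
rewrite ord1 !mxE; set y := Y a 0 j.
have m0 : 0 < m.+1%:R :> R by [].
have em : m.+1%:R^-1 <= e.
  by apply: ltW; near: m; exact: (near_infty_natSinv_lt (PosNum e0)).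
apply: le_trans em.
rewrite -[y in y - _](mulfK (lt0r_neq0 m0)) -mulrBl normrM ger0_norm; last first.
  by rewrite subr_ge0 floor_le.
rewrite ger0_norm ?invr_ge0// ler_piMl ?invr_ge0// lerBlDl.
by rewrite -intrD1 ltW// floorD1_gt.
Unshelve. all: by end_near. Qed.

Lemma caratheodory_measurable : measurable_fun setT (fun a => F (Y a) a).
Proof.
apply: (measurable_fun_cvg measurable_cells) => a _.
apply: (@cvg_comp _ _ _ (fun m => node m (cell m a)) (F ^~ a) \oo (nbhs (Y a))).
  exact: cvg_node.
exact: cF.
Qed.

End Caratheodory.

(** * Independence of one sample from the others *)

Section IndependentPair.
Context d (T : measurableType d) (R : realType) (P : probability T R).
Context d1 (A : measurableType d1) d2 (B : measurableType d2).
Variables (U : T -> A) (V : T -> B).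
Hypotheses (mU : measurable_fun setT U) (mV : measurable_fun setT V).
Hypothesis indepUV : forall C D, measurable C -> measurable D ->
  P (U @^-1` C `&` V @^-1` D) = (P (U @^-1` C) * P (V @^-1` D))%E.

(** By independence, the law of (U, V) is the product of the laws of U and V, so
    the mean of k (U, V) can be computed by integrating over V first. *)
Lemma independent_expectation0 (k : A * B -> R) :
  measurable_fun setT k ->
  integ P (fun w => k (U w, V w)) ->
  (forall a, integ P (fun w => k (a, V w)) /\ Ex P (fun w => k (a, V w)) = 0) ->
  Ex P (fun w => k (U w, V w)) = 0.
Proof.
move=> mk ik k0.
pose Uf : {mfun T >-> A} := mfun_Sub (mem_set mU).
pose Vf : {mfun T >-> B} := mfun_Sub (mem_set mV).
have mW : measurable_fun setT (fun w => (U w, V w)) by exact: measurable_fun_pair.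
pose Wf : {mfun T >-> (A * B)%type} := mfun_Sub (mem_set mW).
pose mu1 := distribution P Uf.
pose mu2 := distribution P Vf.
pose mu := distribution P Wf.
have muE X : measurable X -> (mu1 \x mu2)%E X = mu X.
  apply: product_measure_unique => C D mC mD.
  rewrite /mu /mu1 /mu2 /distribution /pushforward/= -indepUV//.
have mEk : measurable_fun setT (EFin \o k) by exact/measurable_EFinP.
have intmu : mu.-integrable setT (EFin \o k).
  by apply: integrable_pushforward.
have intmu12 : (mu1 \x mu2)%E.-integrable setT (EFin \o k).
  move/integrableP : intmu => [_ lt]; apply/integrableP; split => //.
  rewrite (eq_measure_integral mu)// => X mX _; exact: muE.
rewrite /Ex /Rintegral -[X in fine X]/(\int[P]_w ((EFin \o k) \o Wf) w)%E.
rewrite -integral_distribution//.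
rewrite -(eq_measure_integral mu (m1 := (mu1 \x mu2)%E))//; last first.
  by move=> X mX _; exact: muE.
rewrite -integral12_prod_meas1//=.
rewrite integral0_eq// => a _.
have [ia a0] := k0 a.
have ma : measurable_fun setT (fun b => (k (a, b))%:E).
  by apply/measurable_EFinP; exact: (measurableT_comp mk (measurable_pair1 a)).
rewrite /fubini_F integral_distribution//.
by rewrite EFin_Ex// a0.
Qed.

End IndependentPair.

Section OtherSamples.
Context d (T : measurableType d) (R : realType) (P : probability T R).
Context dE (E : measurableType dE) (K : finType) (X : K -> {RV P >-> E}).
Hypothesis indX : mutually_independent X.
Variable k0 : K.

(** The events that are finite intersections of conditions on samples other than
    k0. They form a pi-system, which generates the information carried by these
    samples. *)
Definition other_events : set (set T) := [set B | exists (J : {set K}) (A : K -> set E),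
  [/\ k0 \notin J, forall k, measurable (A k) &
      B = \bigcap_(k in [set k | k \in J]) (X k @^-1` A k)]].

(** The sample space with the sigma-algebra of the other samples. Functions of
    these samples are encoded as functions which are measurable on this type,
    and an independence statement becomes one on the type times E. *)
Definition other_samples := g_sigma_algebraType other_events.

Lemma other_events_measurable : other_events `<=` measurable.
Proof.
move=> _ [J [A [_ mA ->]]]; apply: fin_bigcap_measurable => // k _.
by rewrite -[X in measurable X]setTI; exact: measurable_funPT.
Qed.

Lemma other_events_setI : setI_closed other_events.
Proof.
move=> _ _ [J1 [A1 [k1 m1 ->]]] [J2 [A2 [k2 m2 ->]]].
exists (J1 :|: J2)%SET.
exists (fun k => (if k \in J1 then A1 k else setT) `&` (if k \in J2 then A2 k else setT)).
split; first by rewrite inE negb_or k1.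
  by move=> k; apply: measurableI; case: ifP.
apply/seteqP; split => [w [/= w1 w2] k /=|w /= w12].
  rewrite inE => k12; split; case: ifP => // kJ; [exact: w1|exact: w2].
split => k /= kJ; have := w12 k; rewrite /= inE kJ ?orbT => /(_ isT)[]; by [].
Qed.

Lemma other_samples_id : measurable_fun setT (fun w : T => w : other_samples).
Proof.
move=> _ B mB; rewrite setTI.
exact: (smallest_sub (@sigma_algebra_measurable _ T) other_events_measurable).
Qed.

Lemma measurable_other_sample k : k != k0 ->
  measurable_fun setT (X k : other_samples -> E).
Proof.
move=> kk0 _ B mB; rewrite setTI; apply: sub_sigma_algebra.
exists [set k]%SET, (fun=> B); split => //; first by rewrite finset.in_set1 eq_sym.
apply/seteqP; split => [w /= wB j|w /= wB]; last by apply: wB; rewrite /= finset.in_set1.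
by rewrite /= finset.in_set1 => /eqP ->.
Qed.

(** With the event on the sample k0 fixed, both sides are finite measures of C.
    They agree on the pi-system, hence on the generated sigma-algebra. *)
Lemma other_samples_independent (C : set T) (D : set E) :
  (measurable : set (set other_samples)) C -> measurable D ->
  P (C `&` X k0 @^-1` D) = (P C * P (X k0 @^-1` D))%E.
Proof.
move=> mC mD.
have mXD : measurable (X k0 @^-1` D).
  by rewrite -[X in measurable X]setTI; exact: measurable_funPT.
pose p := fine (P (X k0 @^-1` D)).
have p0 : 0 <= p by rewrite fine_ge0.
have pE : P (X k0 @^-1` D) = p%:E by rewrite fineK// fin_num_measure.
rewrite pE muleC.
pose m1 := mrestr P mXD.
pose m2 := mscale (NngNum p0) P.
apply: (@g_sigma_algebra_measure_unique _ R T other_events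
  other_events_measurable (fun=> setT) _ _ m1 m2) => //.
- move=> _; exists finset.set0, (fun=> setT); split => //; first by rewrite finset.in_set0.
  by apply/seteqP; split => // w _ k; rewrite /= finset.in_set0.
- by apply/seteqP; split => // w _; exists 0%N.
- exact: other_events_setI.
- move=> _ [J [A [kJ mA ->]]].
  rewrite [RHS](_ : _ = (p%:E * P (\bigcap_(k in [set k | k \in J]) (X k @^-1` A k)))%E)//.
  rewrite -[LHS]/(P (\bigcap_(k in [set k | k \in J]) (X k @^-1` A k) `&` X k0 @^-1` D)) -pE.
  pose A' k := if k == k0 then D else A k.
  have mA' k : measurable (A' k) by rewrite /A'; case: ifP.
  have A'J k : k \in J -> A' k = A k.
    by rewrite /A'; case: eqVneq => // -> kJ'; rewrite kJ' in kJ.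
  have -> : \bigcap_(k in [set k | k \in J]) (X k @^-1` A k) `&` X k0 @^-1` D =
      \bigcap_(k in [set k | k \in (k0 |: J)%SET]) (X k @^-1` A' k).
    apply/seteqP; split => [w [/= wA wD] k /=|w /= wA].
      rewrite !inE => /predU1P[->|kJ']; first by rewrite /A' eqxx.
      by rewrite A'J//; exact: wA.
    split => [k /= kJ'|]; first by rewrite -A'J//; apply: wA; rewrite /= !inE kJ' orbT.
    by have := wA k0; rewrite /= /A' eqxx; apply; rewrite !inE eqxx.
  rewrite !indX// big_setU1//= {1}/A' eqxx; congr (_ * _)%E.
  by apply: eq_bigr => k kJ'; rewrite A'J.
- move=> _; rewrite -[X in (X < _)%E]/(P (setT `&` X k0 @^-1` D)) setTI.
  by rewrite pE ltry.
Qed.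

(** A conditional expectation in disguise: if k (a, .) has mean zero for each
    frozen value a of the other samples, then k has mean zero. *)
Lemma fresh_sample_expectation0 (k : other_samples * E -> R) :
  measurable_fun setT k ->
  integ P (fun w => k (w, X k0 w)) ->
  (forall a, integ P (fun w => k (a, X k0 w)) /\ Ex P (fun w => k (a, X k0 w)) = 0) ->
  Ex P (fun w => k (w, X k0 w)) = 0.
Proof.
apply: (@independent_expectation0 _ T R P _ other_samples _ E (fun w => w) (X k0)) => //.
  exact: other_samples_id.
move=> C D mC mD; exact: other_samples_independent.
Qed.

End OtherSamples.

(** * Real coordinates of complex vectors *)

Section Coordinates.
Context (R : realType) (d : nat).
Implicit Types (u v : 'CV[R]_d) (G : 'CV[R]_d -> 'CV[R]_d).

(** All estimates are carried out on these 2d real coordinates. *)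
Definition co v (k : 'I_(d + d)) : R := realify v 0 k.

Lemma co_lshift v m : co v (lshift d m) = complex.Re (v 0 m).
Proof. by rewrite /co /realify row_mxEl mxE. Qed.

Lemma co_rshift v m : co v (rshift d m) = complex.Im (v 0 m).
Proof. by rewrite /co /realify row_mxEr mxE. Qed.

Lemma realifyK v : complexify (realify v) = v.
Proof.
apply/rowP => m; rewrite mxE /realify row_mxKl row_mxKr !mxE.
by case: (v 0 m).
Qed.

Lemma complexifyK (x : 'rV[R]_(d + d)) : realify (complexify x) = x.
Proof.
rewrite -[RHS]hsubmxK /realify; congr row_mx; apply/rowP => m; by rewrite !mxE.
Qed.

Lemma coD u v k : co (u + v) k = co u k + co v k.
Proof.
case: (split_ordP k) => m ->; rewrite ?(co_lshift, co_rshift) mxE;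
by case: (u 0 m) (v 0 m) => [a b] [a' b'].
Qed.

Lemma coN v k : co (- v) k = - co v k.
Proof.
case: (split_ordP k) => m ->; rewrite ?(co_lshift, co_rshift) mxE;
by case: (v 0 m) => [a b].
Qed.

Lemma coB u v k : co (u - v) k = co u k - co v k.
Proof. by rewrite coD coN. Qed.

Lemma co0 k : co 0 k = 0.
Proof. by case: (split_ordP k) => m ->; rewrite ?(co_lshift, co_rshift) mxE. Qed.

Lemma co_rscale r v k : co (rscale r v) k = r * co v k.
Proof.
case: (split_ordP k) => m ->; rewrite ?(co_lshift, co_rshift) mxE;
by case: (v 0 m) => [a b] /=; rewrite mul0r (subr0, addr0).
Qed.

Lemma co_sum (J : finType) (p : pred J) (F : J -> 'CV[R]_d) k :
  co (\sum_(j | p j) F j) k = \sum_(j | p j) co (F j) k.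
Proof. by apply: (big_morph (fun v => co v k)) => [u v|]; rewrite ?coD ?co0. Qed.

Lemma norm2E v : norm2 v = l2 (co v).
Proof.
rewrite /norm2 /l2 big_split_ord big_split/=; congr (Num.sqrt (_ + _));
by apply: eq_bigr => m _; rewrite (co_lshift, co_rshift).
Qed.

Definition coord G k (x : 'rV[R]_(d + d)) : R := co (G (complexify x)) k.

Lemma coord_lshift G m : coord G (lshift d m) = coordRe (fun v => G v 0 m).
Proof. by apply/funext => x; rewrite /coord co_lshift. Qed.

Lemma coord_rshift G m : coord G (rshift d m) = coordIm (fun v => G v 0 m).
Proof. by apply/funext => x; rewrite /coord co_rshift. Qed.

Lemma l2_coordinate_le (x : 'I_(d + d) -> R) (c : R) : 0 <= c ->
  (forall k, `|x k| <= c) -> l2 x <= Num.sqrt (d + d)%:R * c.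
Proof. by move=> c0 xc; have := l2_coord_le c0 xc; rewrite card_ord. Qed.

Section Lipschitz.
Variables (G : 'CV[R]_d -> 'CV[R]_d) (M1 : R).
Hypothesis M1_ge0 : 0 <= M1.
Hypothesis G_grad_derivable : forall k, grad_derivable (coord G k).
Hypothesis G_grad : forall u m, grad_norm (fun v => G v 0 m) u <= M1.

(** The gradient norm of a complex coordinate dominates those of its real and
    imaginary parts. *)
Lemma coord_grad k x : l2 (fun j => partial j (coord G k) x) <= M1.
Proof.
rewrite -[x]complexifyK; set u := complexify x.
case: (split_ordP k) => m ->; apply: le_trans (G_grad u m);
  rewrite ?(coord_lshift, coord_rshift); apply: ler_wsqrtr; apply: ler_sum => j _.
  by rewrite lerDl sqr_ge0.
by rewrite lerDr sqr_ge0.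
Qed.

Lemma lipschitz_co u v :
  l2 (fun k => co (G v) k - co (G u) k) <=
  Num.sqrt (d + d)%:R * M1 * l2 (fun k => co v k - co u k).
Proof.
rewrite -mulrA; apply: l2_coordinate_le => [|k]; first by rewrite mulr_ge0 ?l2_ge0.
have := grad_derivable_lipschitz (G_grad_derivable k) (coord_grad k) (realify u) (realify v).
by rewrite /coord !realifyK.
Qed.

Lemma grad_co_lipschitz u (x : 'I_(d + d) -> R) :
  l2 (fun k => \sum_j partial j (coord G k) (realify u) * x j) <=
  Num.sqrt (d + d)%:R * M1 * l2 x.
Proof.
rewrite -mulrA; apply: l2_coordinate_le => [|k]; first by rewrite mulr_ge0 ?l2_ge0.
apply: le_trans (norm_CauchySchwarz _ _) _.
by rewrite ler_wpM2r ?l2_ge0// coord_grad.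
Qed.

Variable M2 : R.
Hypothesis M2_ge0 : 0 <= M2.
Hypothesis G_grad_derivable2 : forall k j, grad_derivable (partial j (coord G k)).
Hypothesis G_hess : forall u m, hess_norm (fun v => G v 0 m) u <= M2.

Lemma coord_hess k x :
  Num.sqrt (\sum_j \sum_l partial j (partial l (coord G k)) x ^+ 2) <= M2.
Proof.
rewrite -[x]complexifyK; set u := complexify x.
case: (split_ordP k) => m ->; apply: le_trans (G_hess u m);
  rewrite ?(coord_lshift, coord_rshift); apply: ler_wsqrtr;
  apply: ler_sum => j _; apply: ler_sum => l _.
  by rewrite lerDl sqr_ge0.
by rewrite lerDr sqr_ge0.
Qed.

Lemma taylor_co u v :
  l2 (fun k => co (G v) k - co (G u) k -
    \sum_j partial j (coord G k) (realify u) * (co v j - co u j)) <=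
  Num.sqrt (d + d)%:R * M2 * l2 (fun k => co v k - co u k) ^+ 2.
Proof.
rewrite -mulrA; apply: l2_coordinate_le => [|k]; first by rewrite mulr_ge0 ?sqr_ge0.
have := grad_derivable_taylor (G_grad_derivable k) (G_grad_derivable2 k)
  (coord_hess k) (realify u) (realify v).
rewrite /coord !realifyK; under eq_bigr do rewrite mulrC; exact.
Qed.

End Lipschitz.

Lemma rdifferentiable_coord G k u : 
  (forall m, rdifferentiable (fun v => G v 0 m) u) ->
  differentiable (coord G k) (realify u).
Proof.
by move=> dG; case: (split_ordP k) => m ->;
  rewrite ?(coord_lshift, coord_rshift); case: (dG m).
Qed.

Lemma Ck_on_coord (J : set R) p (f : R -> 'CV[R]_d -> 'CV[R]_d) t k :
  Ck_on J p.+2 f -> J t ->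
  [/\ continuous (coord (f t) k), grad_derivable (coord (f t) k) &
      forall j, grad_derivable (partial j (coord (f t) k))].
Proof.
case=> F [Ff CF] Jt.
have E : coord (f t) k = (fun x => realify (F t (complexify x)) 0 k).
  by apply/funext => x; rewrite /coord /co Ff.
have [g1 g2] := Ck_slice_grad_derivable t k CF; rewrite E; split => //.
by case: CF => cF _ _; have := @continuous_slice R _ _ t k cF; exact.
Qed.

End Coordinates.

(** * Runge-Kutta schemes in coordinates *)

Section RungeKuttaCoordinates.
Context (R : realType) (s : nat) (tab : explicit_rk R s) (d : nat).

Lemma co_rk_arg h (u : 'CV[R]_d) ks i k : co (rk_arg tab h u ks i) k =
  co u k + h * \sum_(j < s | (j < i)%N) rk_a tab i j * co (ks j) k.
Proof.
rewrite /rk_arg coD co_rscale co_sum; congr (_ + _ * _).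
by apply: eq_bigr => j _; rewrite co_rscale.
Qed.

Lemma co_rk_step h F (u : 'CV[R]_d) k : co (rk_step tab h F u) k =
  co u k + h * \sum_i rk_b tab i * co (rk_stages tab h F u i) k.
Proof.
rewrite /rk_step coD co_rscale co_sum; congr (_ + _ * _).
by apply: eq_bigr => j _; rewrite co_rscale.
Qed.

Lemma co_mc_slope (E : Type) (g : R -> 'CV[R]_d -> E -> 'CV[R]_d) h Ns
    (x : nat -> 'I_s -> 'I_Ns -> E) n i v k :
  co (mc_slope tab g h x n i v) k =
  Ns%:R^-1 * \sum_l co (g (stage_time tab h n i) v (x n i l)) k.
Proof. by rewrite /mc_slope co_rscale co_sum. Qed.

End RungeKuttaCoordinates.

Section SchemeMeasurability.
Context dA (A : measurableType dA) dE (E : measurableType dE) (R : realType).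
Context (s : nat) (tab : explicit_rk R s) (d : nat) (J : set R) (h : R) (Ns : nat).
Variables (g : R -> 'CV[R]_d -> E -> 'CV[R]_d) (N : nat).
Variable x : A -> nat -> 'I_s -> 'I_Ns -> E.
Hypothesis g_meas : forall t u m, J t ->
     measurable_fun [set: E] (fun x => complex.Re (g t u x 0 m)) /\
     measurable_fun [set: E] (fun x => complex.Im (g t u x 0 m)).
Hypothesis g_cont : forall t z k, J t -> continuous (coord (fun u => g t u z) k).
Hypothesis stageJ : forall n i, (n < N)%N -> J (stage_time tab h n i).

Definition measurable_co (U : A -> 'CV[R]_d) :=
  forall k, measurable_fun setT (fun a => co (U a) k).

Lemma measurable_g t u k : J t -> measurable_fun setT (fun z => co (g t u z) k).
Proof.
move=> Jt; case: (split_ordP k) => m ->.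
  by under eq_fun do rewrite co_lshift; case: (g_meas u m Jt).
by under eq_fun do rewrite co_rshift; case: (g_meas u m Jt).
Qed.

Lemma measurable_co_g t (Y : A -> 'CV[R]_d) (z : A -> E) : J t ->
  measurable_co Y -> measurable_fun setT z ->
  measurable_co (fun a => g t (Y a) (z a)).
Proof.
move=> Jt mY mz k.
have := @caratheodory_measurable _ A R (d + d)
  (fun y a => coord (fun u => g t u (z a)) k y) (fun a => realify (Y a)).
rewrite /coord; under [X in _ -> _ -> _ -> measurable_fun _ X]eq_fun do
  rewrite realifyK.
apply => // [y|a].
  exact: (measurableT_comp (measurable_g _ k Jt) mz).
exact: g_cont.
Qed.

Lemma measurable_co_mc_slope n i (Y : A -> 'CV[R]_d) : (n < N)%N ->
  measurable_co Y -> (forall l, measurable_fun setT (fun a => x a n i l)) ->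
  measurable_co (fun a => mc_slope tab g h (x a) n i (Y a)).
Proof.
move=> nN mY mx k; under eq_fun do rewrite co_mc_slope.
apply: measurable_funM => //; apply: measurable_sum => l.
by apply: measurable_co_g => //; exact: stageJ.
Qed.

Lemma measurable_co_rk_arg (U : A -> 'CV[R]_d) (ks : A -> 'I_s -> 'CV[R]_d) (i : 'I_s) :
  measurable_co U ->
  (forall j : 'I_s, (j < i)%N -> measurable_co (fun a => ks a j)) ->
  measurable_co (fun a => rk_arg tab h (U a) (ks a) i).
Proof.
move=> mU mks k.
rewrite (_ : (fun a => _) = fun a => co (U a) k + h *
    \sum_(j < s) if (j < i)%N then rk_a tab i j * co (ks a j) k else 0); last first.
  by apply/funext => a; rewrite co_rk_arg; congr (_ + _ * _); exact: big_mkcond.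
apply: measurable_funD => //; apply: measurable_funM => //.
apply: measurable_sum => j; have [ji|ji] := boolP (j < i)%N => //.
by apply: measurable_funM => //; exact: mks.
Qed.

(** Only the samples of the first i stages are used, because the slope of a
    stage depends on its own samples and on the earlier slopes. With the
    sigma-algebra of the samples other than one of stage i, this says that the
    argument of stage i does not depend on that sample. *)
Lemma measurable_co_stage n (U : A -> 'CV[R]_d) (i : nat) : (n < N)%N ->
  measurable_co U ->
  (forall (j : 'I_s) l, (j < i)%N -> measurable_fun setT (fun a => x a n j l)) ->
  forall j : 'I_s, (j < i)%N ->
    measurable_co (fun a => rk_stages tab h (mc_slope tab g h (x a) n) (U a) j).
Proof.
move=> nN mU; elim: i => // i IH mx j ji k.
under eq_fun do rewrite rk_stagesE.
apply: measurable_co_mc_slope => // [|l]; last exact: mx.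
apply: measurable_co_rk_arg => // j' j'j; apply: IH => [j1 l j1i|].
  by apply: mx; rewrite ltnS ltnW.
by rewrite (leq_trans j'j).
Qed.

Lemma measurable_co_mc_sol u0 n : (n <= N)%N ->
  (forall n' j l, (n' < n)%N -> measurable_fun setT (fun a => x a n' j l)) ->
  measurable_co (fun a => mc_sol tab g h u0 (x a) n).
Proof.
elim: n => [|n IH] nN mx k; first exact: (measurable_cst (co u0 k)).
have mU : measurable_co (fun a => mc_sol tab g h u0 (x a) n).
  by apply: IH => [|n' j l n'n]; [exact: ltnW|apply: mx; rewrite ltnS ltnW].
under eq_fun do rewrite co_rk_step.
apply: measurable_funD; first exact: mU.
apply: measurable_funM => //; apply: measurable_sum => j.
apply: measurable_funM => //.
by apply: (measurable_co_stage (i := s)) => // j' l _; exact: mx.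
Qed.

End SchemeMeasurability.

(** * The Monte Carlo scheme *)

Section Transfer.
Context d (T : measurableType d) (R : realType) (P : probability T R).

(** The difference of the integrals of the positive and the negative part is
    finite only if both integrals are. *)
Lemma integ_of_expectation (f : T -> R) (c : R) : measurable_fun setT f ->
  ('E_P[f] = c%:E)%E -> integ P f /\ Ex P f = c.
Proof.
move=> mf; rewrite unlock => fc.
suff fi : integ P f by split=> //; rewrite /Ex /Rintegral fc.
have mEf : measurable_fun setT (EFin \o f) by exact/measurable_EFinP.
move: fc; rewrite integralE => fc.
have : ((\int[P]_x (EFin \o f)^\+ x - \int[P]_x (EFin \o f)^\- x) \is a fin_num)%E.
  by rewrite fc.
rewrite fin_numB => /andP[f1 f2].
have p1 : P.-integrable setT (EFin \o f)^\+%E.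
  apply/integrableP; split; first exact: measurable_funepos.
  by under eq_integral do rewrite gee0_abs//; rewrite ltey_eq f1.
have p2 : P.-integrable setT (EFin \o f)^\-%E.
  apply/integrableP; split; first exact: measurable_funeneg.
  by under eq_integral do rewrite gee0_abs//; rewrite ltey_eq f2.
by rewrite /integ [EFin \o f]funeposneg; exact: integrableB.
Qed.

Context d1 (T1 : measurableType d1) (P1 : probability T1 R).
Context dE (E : measurableType dE) (Y : {RV P >-> E}) (X : {RV P1 >-> E}).
Hypothesis YX : same_law Y X.

Lemma same_law_Ex (phi : E -> R) : measurable_fun setT phi ->
  integ P1 (phi \o X) -> integ P (phi \o Y) /\ Ex P (phi \o Y) = Ex P1 (phi \o X).
Proof.
move=> mphi iX.
have mE : measurable_fun setT (EFin \o phi) by exact/measurable_EFinP.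
have eqm A : measurable A -> A `<=` setT -> distribution P Y A = distribution P1 X A.
  by move=> mA _; exact: YX.
have int_eq (u : E -> \bar R) :
    (\int[distribution P Y]_z u z = \int[distribution P1 X]_z u z)%E.
  by apply: eq_measure_integral => A mA AT; exact: eqm.
have iY : integ P (phi \o Y).
  apply/integrableP; split; first by apply/measurable_EFinP; exact: measurableT_comp.
  move/integrableP : iX => [_].
  have a0 y : (0 <= (abse \o (EFin \o phi)) y)%E by exact: abse_ge0.
  have m2 : measurable_fun setT (abse \o (EFin \o phi)) by exact: measurableT_comp.
  rewrite -[X in (X < _)%E -> _](@ge0_integral_distribution _ _ _ _ _ P1 X (abse \o (EFin \o phi)))//.
  rewrite -[X in _ -> (X < _)%E](@ge0_integral_distribution _ _ _ _ _ P Y (abse \o (EFin \o phi)))//.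
  by rewrite (int_eq (abse \o (EFin \o phi))).
split => //; rewrite /Ex /Rintegral; congr fine.
rewrite -[LHS](@integral_distribution _ _ _ _ _ P Y (EFin \o phi))//.
by rewrite -[RHS](@integral_distribution _ _ _ _ _ P1 X (EFin \o phi)).
Qed.

End Transfer.

Lemma subr_subr_split (R : comRingType) (a1 a2 a3 a4 : R) :
  a1 - a3 = (a2 - a4) + ((a1 - a2) - (a3 - a4)).
Proof. ring. Qed.

Section Scheme.
Context (R : realType) (d : nat) (J : set R).
Context (s : nat) (tab : explicit_rk R s).
Variables (f : R -> 'CV[R]_d -> 'CV[R]_d) (u0 : 'CV[R]_d).
Context (d1 : measure_display) (Omega1 : measurableType d1).
Context (P1 : probability Omega1 R).
Context (dE : measure_display) (E : measurableType dE) (X : {RV P1 >-> E}).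
Variable g : R -> 'CV[R]_d -> E -> 'CV[R]_d.
Hypothesis g_meas : forall t u m, J t ->
     measurable_fun [set: E] (fun x => complex.Re (g t u x 0 m)) /\
     measurable_fun [set: E] (fun x => complex.Im (g t u x 0 m)).
Hypothesis g_mean : forall t u m, J t ->
     has_expectation P1 (fun w => g t u (X w) 0 m) (f t u 0 m).
Hypothesis g_cont : forall t z k, J t -> continuous (coord (fun u => g t u z) k).
Hypothesis f_cont : forall t k, J t -> continuous (coord (f t) k).
Context (N Ns : nat) (h : R).
Hypothesis Ns_gt0 : (0 < Ns)%N.
Hypothesis stageJ : forall (n : nat) (i : 'I_s), (n < N)%N -> J (stage_time tab h n i).
Context (d2 : measure_display) (Omega : measurableType d2).
Context (P : probability Omega R) (x : nat -> 'I_s -> 'I_Ns -> {RV P >-> E}).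
Hypothesis iid : iid_samples X N x.

Definition samples (w : Omega) n i l : E := x n i l w.

Lemma g_expectation t u k : J t ->
  integ P1 (fun w => co (g t u (X w)) k) /\
  Ex P1 (fun w => co (g t u (X w)) k) = co (f t u) k.
Proof.
move=> Jt.
apply: integ_of_expectation.
  exact: (measurableT_comp (measurable_g g_meas u k Jt)).
case: (split_ordP k) => m ->; have [h1 h2] := g_mean u m Jt.
  by rewrite co_lshift -h1; congr expectation; apply/funext => w; rewrite co_lshift.
by rewrite co_rshift -h2; congr expectation; apply/funext => w; rewrite co_rshift.
Qed.

(** [caratheodory_measurable] for a function that is constant in the second
    variable. *)
Lemma measurable_co_f dA (A : measurableType dA) t (Y : A -> 'CV[R]_d) : J t ->
  measurable_co Y -> measurable_co (fun a => f t (Y a)).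
Proof.
move=> Jt mY k.
have := @caratheodory_measurable _ A R (d + d)
  (fun y a => coord (f t) k y) (fun a => realify (Y a)).
rewrite /coord; under [X in _ -> _ -> _ -> measurable_fun _ X]eq_fun do
  rewrite realifyK.
by apply => // a; exact: f_cont.
Qed.

(** The deviation from f caused by the single sample l of stage i of step n, at
    an argument u that may itself be random. *)
Definition noise t u l n i k (w : Omega) : R :=
  co (g t u (x n i l w)) k - co (f t u) k.

Section OneSample.
Variables (n : nat) (i : 'I_s).
Hypothesis nN : (n < N)%N.

Lemma sample_Ex l (phi : E -> R) : measurable_fun setT phi ->
  integ P1 (phi \o X) ->
  integ P (phi \o x n i l) /\ Ex P (phi \o x n i l) = Ex P1 (phi \o X).
Proof. by apply: same_law_Ex; case: iid => + _; exact. Qed.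

Lemma noise_mean t u l k : J t -> integ P (noise t u l n i k) /\ Ex P (noise t u l n i k) = 0.
Proof.
move=> Jt; have [ig gE] := g_expectation u k Jt.
have [ix xE] := sample_Ex l (measurable_g g_meas u k Jt) ig.
split; first exact: integB ix (integ_cst _ _).
by rewrite /noise ExB//; [rewrite Ex_cst -gE -xE subrr|exact: integ_cst].
Qed.

Definition sample_index l : 'I_N * 'I_s * 'I_Ns := (Ordinal nN, i, l).
Definition sample_family (k : 'I_N * 'I_s * 'I_Ns) := x k.1.1 k.1.2 k.2.
(** The information of all samples of the first N steps but one. *)
Definition others l := other_samples sample_family (sample_index l).

Lemma measurable_other n' i' l l' : (n' < N)%N -> [|| n' != n, i' != i | l' != l] ->
  measurable_fun setT (x n' i' l' : others l -> E).
Proof.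
move=> n'N neq.
have := @measurable_other_sample _ _ _ P _ _ _ sample_family (sample_index l)
  (Ordinal n'N, i', l').
apply; rewrite /sample_index -!pair_eqE /pair_eq/= !negb_and -orbA.
exact: neq.
Qed.

(** Given the other samples, Y and Z are constant and the noise at a constant
    argument has mean zero. *)
Lemma fresh_noise_mean0 l t (Y : Omega -> 'CV[R]_d) (Z : Omega -> R) k : J t ->
  measurable_co (Y : others l -> 'CV[R]_d) ->
  measurable_fun setT (Z : others l -> R) ->
  integ P (fun w => Z w * noise t (Y w) l n i k w) ->
  Ex P (fun w => Z w * noise t (Y w) l n i k w) = 0.
Proof.
move=> Jt mY mZ iZ.
have [_ ind] := iid.
pose kf (p : others l * E) := Z p.1 * (co (g t (Y p.1) p.2) k - co (f t (Y p.1)) k).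
have mY1 : measurable_co (fun p : others l * E => Y p.1).
  by move=> j; exact: (measurableT_comp (mY j) measurable_fst).
apply: (@fresh_sample_expectation0 _ _ _ P _ _ _ sample_family ind (sample_index l) kf).
- apply: measurable_funM; first exact: (measurableT_comp mZ measurable_fst).
  apply: measurable_funB; last exact: measurable_co_f.
  exact: (measurable_co_g g_meas g_cont).
- exact: iZ.
- move=> a; have [ia a0] := noise_mean (Y a) l k Jt.
  split; first exact: (integZ (Z a) ia).
  by rewrite -[LHS]/(Ex P (fun w => Z a * noise t (Y a) l n i k w)) ExZ// a0 mulr0.
Qed.

End OneSample.

(** The prefix mc is for the stochastic scheme and rk for the deterministic one;
    the letters u, k and y denote solution, slopes and stage arguments. *)
Definition mc_u n w := mc_sol tab g h u0 (samples w) n.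
Definition mc_k n w := rk_stages tab h (mc_slope tab g h (samples w) n) (mc_u n w).
Definition mc_y n i w := rk_arg tab h (mc_u n w) (mc_k n w) i.
Definition rk_u n := det_sol tab f h u0 n.
Definition rk_k n := rk_stages tab h (det_slope tab f h n) (rk_u n).
Definition rk_y n i := det_arg tab f h u0 n i.

Definition err n w k : R := co (mc_u n w) k - co (rk_u n) k.
Definition arg_err n i w k : R := co (mc_y n i w) k - co (rk_y n i) k.
Definition slope_err n i w k : R := co (mc_k n w i) k - co (rk_k n i) k.
(** The part of the slope error that is left after averaging over the samples
    of the stage. *)
Definition drift_err n i w k : R :=
  co (f (stage_time tab h n i) (mc_y n i w)) k -
  co (f (stage_time tab h n i) (rk_y n i)) k.
Definition det_noise n i w k : R :=
  Ns%:R^-1 * \sum_l noise (stage_time tab h n i) (rk_y n i) l n i k w.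

Lemma rk_kE n i : rk_k n i = f (stage_time tab h n i) (rk_y n i).
Proof. by rewrite /rk_k rk_stagesE. Qed.

Lemma mc_kE n i w k : co (mc_k n w i) k =
  Ns%:R^-1 * \sum_l co (g (stage_time tab h n i) (mc_y n i w) (x n i l w)) k.
Proof. by rewrite /mc_k rk_stagesE co_mc_slope. Qed.

Lemma arg_errE n i w k : arg_err n i w k = err n w k +
  h * \sum_(j < s | (j < i)%N) rk_a tab i j * slope_err n j w k.
Proof.
rewrite /arg_err /mc_y /rk_y /det_arg !co_rk_arg /err /slope_err.
under [in RHS]eq_bigr do rewrite mulrBr.
by rewrite sumrB; ring.
Qed.

Lemma errS n w k : err n.+1 w k = err n w k +
  h * \sum_i rk_b tab i * slope_err n i w k.
Proof.
rewrite /err /mc_u /rk_u /det_sol /mc_sol [in LHS]/= !co_rk_step /slope_err.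
under [in RHS]eq_bigr do rewrite mulrBr.
by rewrite sumrB /mc_k /rk_k /mc_u /rk_u /mc_sol /det_sol; ring.
Qed.

Let Ns0 : Ns%:R != 0 :> R.
Proof. by rewrite pnatr_eq0 -lt0n. Qed.

Lemma sample_mean_cst (c : R) : Ns%:R^-1 * \sum_(l < Ns) c = c.
Proof. by rewrite sumr_const card_ord -[c *+ _]mulr_natl mulrA mulVf// mul1r. Qed.

(** The first splitting of the slope error: exact slopes plus the noise at the
    random argument. *)
Lemma slope_errB n i w k : slope_err n i w k - drift_err n i w k =
  Ns%:R^-1 * \sum_l noise (stage_time tab h n i) (mc_y n i w) l n i k w.
Proof.
rewrite /noise sumrB mulrBr sample_mean_cst -mc_kE /slope_err rk_kE /drift_err.
by rewrite opprB addrA subrK.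
Qed.

(** The second splitting: noise at the deterministic argument plus increments of
    g with the samples fixed. *)
Lemma slope_err_noise n i w k : slope_err n i w k - det_noise n i w k =
  Ns%:R^-1 * \sum_l (co (g (stage_time tab h n i) (mc_y n i w) (x n i l w)) k -
    co (g (stage_time tab h n i) (rk_y n i) (x n i l w)) k).
Proof.
rewrite /slope_err mc_kE rk_kE /det_noise /noise !sumrB !mulrBr sample_mean_cst.
by rewrite opprB addrA subrK.
Qed.

Lemma slope_err_lip (L : R) n i w :
  (forall z u v, l2 (fun k => co (g (stage_time tab h n i) v z) k -
      co (g (stage_time tab h n i) u z) k) <= L * l2 (fun k => co v k - co u k)) ->
  l2 (fun k => slope_err n i w k - det_noise n i w k) <= L * l2 (arg_err n i w).
Proof.
move=> g_lip; rewrite (eq_l2 (slope_err_noise n i w)) l2Z ger0_norm ?invr_ge0//.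
rewrite -[leRHS]sample_mean_cst ler_wpM2l ?invr_ge0//.
apply: le_trans (l2_sum _ _) _; apply: ler_sum => l _; exact: g_lip.
Qed.

Section Past.
Variables (n : nat) (i : 'I_s) (l : 'I_Ns).
Hypothesis nN : (n < N)%N.

Lemma past_mc_u : measurable_co (mc_u n : others i nN l -> _).
Proof.
apply: (measurable_co_mc_sol (A := others i nN l) (x := samples) (N := N) g_meas g_cont stageJ).
  exact: ltnW.
move=> n' j l' n'n; apply: measurable_other; first exact: ltn_trans nN.
by rewrite neq_ltn n'n.
Qed.

Lemma past_mc_y : measurable_co (mc_y n i : others i nN l -> _).
Proof.
apply: measurable_co_rk_arg; first exact: past_mc_u.
move=> j ji.
apply: (measurable_co_stage (x := samples) (i := i) (A := others i nN l) g_meas g_cont stageJ nN _ _ ji).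
  exact: past_mc_u.
move=> j' l' j'i; apply: measurable_other => //.
by rewrite (_ : j' != i) ?orbT// neq_ltn j'i.
Qed.

Lemma past_err k : measurable_fun setT (fun w : others i nN l => err n w k).
Proof. by apply: measurable_funB => //; exact: past_mc_u. Qed.

End Past.

Lemma measurable_mc_u n : (n <= N)%N -> measurable_co (mc_u n).
Proof.
move=> nN.
by apply: (measurable_co_mc_sol (x := samples) (N := N) g_meas g_cont stageJ).
Qed.

Lemma measurable_mc_k n i : (n < N)%N -> measurable_co (fun w => mc_k n w i).
Proof.
move=> nN.
apply: (measurable_co_stage (x := samples) (i := s) g_meas g_cont stageJ nN) => //.
exact: measurable_mc_u (ltnW nN).
Qed.

Lemma measurable_mc_y n i : (n < N)%N -> measurable_co (mc_y n i).
Proof.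
move=> nN; apply: measurable_co_rk_arg => [|j _].
  exact: measurable_mc_u (ltnW nN).
exact: measurable_mc_k.
Qed.


Lemma det_noise_mean n i k : (n < N)%N ->
  integ P (fun w => det_noise n i w k) /\ Ex P (fun w => det_noise n i w k) = 0.
Proof.
move=> nN.
have nm l := noise_mean i nN (rk_y n i) l k (stageJ i nN).
have iS : integ P (fun w => \sum_l noise (stage_time tab h n i) (rk_y n i) l n i k w).
  by apply: integ_sum => l _; case: (nm l).
split; first exact: integZ.
rewrite ExZ// Ex_sum => [|l _]; last by case: (nm l).
by rewrite big1 ?mulr0// => l _; case: (nm l).
Qed.

Lemma err0 w k : err 0 w k = 0.
Proof. exact: subrr. Qed.

Variables (L Rb : R).
Let A := s%:R * Rb * L.
Hypotheses (h_ge0 : 0 <= h) (h_le1 : h <= 1) (L_ge0 : 0 <= L) (Rb_ge0 : 0 <= Rb).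
Hypothesis a_bound : forall i j : 'I_s, (j < i)%N -> `|rk_a tab i j| <= Rb.
Hypothesis b_bound : forall i : 'I_s, `|rk_b tab i| <= Rb.
Hypothesis g_lip : forall t z u v, J t ->
  l2 (fun k => co (g t v z) k - co (g t u z) k) <= L * l2 (fun k => co v k - co u k).
Hypothesis f_lip : forall t u v, J t ->
  l2 (fun k => co (f t v) k - co (f t u) k) <= L * l2 (fun k => co v k - co u k).

(** If Rb = 0 all weights vanish; if L = 0 then g is constant in u and the slope
    error is the noise at the deterministic argument. In both cases e_n is a sum
    of centred terms. Only first moments are involved, so the variances may be
    infinite. *)
Lemma noiseless_mean n : (n <= N)%N -> Rb * L = 0 ->
  (forall k, integ P (fun w => err n w k)) /\ forall k, Exv P (err n) k = 0.
Proof.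
move=> nN /eqP RL0; elim: n nN => [|n IH] nN.
  split=> k; first by under eq_fun do rewrite err0; exact: integ_cst.
  by rewrite /Exv; under eq_fun do rewrite err0; rewrite Ex_cst.
have [ie e0] := IH (ltnW nN).
have bE i w k : rk_b tab i * slope_err n i w k = rk_b tab i * det_noise n i w k.
  move: RL0; rewrite mulf_eq0 => /orP[/eqP R0|/eqP L0].
    by have := b_bound i; rewrite R0 normr_le0 => /eqP ->; rewrite !mul0r.
  have := @slope_err_lip L n i w (fun z u v => g_lip z u v (stageJ i nN)).
  rewrite L0 mul0r => l20.
  have := le_trans (l2_coord (fun k => slope_err n i w k - det_noise n i w k) k) l20.
  by rewrite normr_le0 subr_eq0 => /eqP ->.
have eS w k : err n.+1 w k = err n w k + h * \sum_i rk_b tab i * det_noise n i w k.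
  by rewrite errS; congr (_ + _ * _); apply: eq_bigr => i _; rewrite bE.
have ib k : integ P (fun w => \sum_i rk_b tab i * det_noise n i w k).
  by apply: integ_sum => i _; apply: integZ; case: (det_noise_mean i k nN).
split=> k.
  under eq_fun do rewrite eS; exact: integD (ie k) (integZ _ (ib k)).
rewrite /Exv; under eq_fun do rewrite eS.
rewrite ExD//; last exact: integZ.
rewrite -/(Exv P (err n) k) e0 add0r ExZ// Ex_sum => [|i _]; last first.
  by apply: integZ; case: (det_noise_mean i k nN).
rewrite big1 ?mulr0// => i _; have [idn dn0] := det_noise_mean i k nN.
by rewrite ExZ// dn0 mulr0.
Qed.

Section FiniteVariance.
Variable sigma2 : R.
Hypothesis sigma2_ge0 : 0 <= sigma2.
Let dev n i k w := co (g (stage_time tab h n i) (rk_y n i) (X w)) k -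
  co (f (stage_time tab h n i) (rk_y n i)) k.
Hypothesis dev_sq : forall n i k, (n < N)%N -> integ P1 (fun w => dev n i k w ^+ 2).
Hypothesis dev_var : forall n i, (n < N)%N ->
  \sum_k Ex P1 (fun w => dev n i k w ^+ 2) <= sigma2.

Section FixedStage.
Variables (n : nat) (i : 'I_s).
Hypothesis nN : (n < N)%N.
Let t := stage_time tab h n i.
Let Jt : J t. Proof. exact: stageJ. Qed.

Lemma noise_sqint l k : sqint P (noise t (rk_y n i) l n i k) /\
  Ex P (fun w => noise t (rk_y n i) l n i k w ^+ 2) = Ex P1 (fun w => dev n i k w ^+ 2).
Proof.
have mg := measurable_g g_meas (rk_y n i) k Jt.
have mn : measurable_fun setT (fun z => co (g t (rk_y n i) z) k - co (f t (rk_y n i)) k).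
  exact: measurable_funB.
have mphi := measurable_funX 2 mn.
have [i1 E1] := sample_Ex i nN l mphi (dev_sq i k nN).
split=> //; split => //; exact: (measurableT_comp mn (measurable_funPT (x n i l))).
Qed.

(** The sample l' belongs to the other samples of l, so the noise of l' may play
    the role of the frozen factor. *)
Lemma noise_uncorrelated l l' k : l' != l ->
  Ex P (fun w => noise t (rk_y n i) l' n i k w * noise t (rk_y n i) l n i k w) = 0.
Proof.
move=> ll'.
apply: (@fresh_noise_mean0 n i nN l t (fun=> rk_y n i)) => //.
- apply: measurable_funB => //.
  apply: (measurableT_comp (measurable_g g_meas (rk_y n i) k Jt)).
  by apply: measurable_other => //; rewrite ll' !orbT.
- by apply: sqintM; case: (noise_sqint l k); case: (noise_sqint l' k).
Qed.

Lemma det_noise_sqintv : sqintv P (det_noise n i).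
Proof.
move=> k; apply: sqintZ; apply: sqint_sum => l _; by case: (noise_sqint l k).
Qed.

(** The variance of a mean of N_s uncorrelated terms. *)
Lemma det_noise_var : Ex P (fun w => l2 (det_noise n i w) ^+ 2) <= sigma2 / Ns%:R.
Proof.
under eq_fun do rewrite l2_sq.
rewrite Ex_sum => [|k _]; last by case: (det_noise_sqintv k).
have dk k : Ex P (fun w => det_noise n i w k ^+ 2) =
    Ns%:R^-1 * Ex P1 (fun w => dev n i k w ^+ 2).
  pose ns l w := noise t (rk_y n i) l n i k w.
  have nsq l : sqint P (ns l) by case: (noise_sqint l k).
  have -> : (fun w => det_noise n i w k ^+ 2) =
      fun w => Ns%:R^-1 ^+ 2 * \sum_l \sum_l' ns l' w * ns l w.
    apply/funext => w; rewrite /det_noise exprMn; congr (_ * _).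
    rewrite expr2 mulr_suml; apply: eq_bigr => l _; rewrite mulr_sumr.
    by apply: eq_bigr => l' _; rewrite mulrC.
  rewrite ExZ; last by do 2 apply: integ_sum => ? _; exact: sqintM.
  rewrite Ex_sum => [|l _]; last by apply: integ_sum => ? _; exact: sqintM.
  have El l : Ex P (fun w => \sum_l' ns l' w * ns l w) =
      Ex P1 (fun w => dev n i k w ^+ 2).
    rewrite Ex_sum => [|l' _]; last exact: sqintM.
    rewrite (bigD1 l)//= big1 => [|l' ll']; last exact: noise_uncorrelated.
    by rewrite addr0; have [_ <-] := noise_sqint l k; under eq_fun do rewrite -expr2.
  under eq_bigr do rewrite El.
  rewrite expr2 -mulrA; congr (_ * _); exact: sample_mean_cst.
under eq_bigr do rewrite dk.
by rewrite -mulr_sumr mulrC ler_wpM2r ?invr_ge0// dev_var.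
Qed.

Lemma slope_err_measurable k : measurable_fun setT (fun w => slope_err n i w k).
Proof. by apply: measurable_funB => //; exact: measurable_mc_k. Qed.

Lemma drift_err_measurable k : measurable_fun setT (fun w => drift_err n i w k).
Proof.
apply: measurable_funB => //; apply: measurable_co_f => //; exact: measurable_mc_y.
Qed.

(** The noise at the random argument differs from the noise at the deterministic
    one by at most 2 L |arg_err|. *)
Lemma noise_mc_y_sqint l k : sqintv P (arg_err n i) ->
  sqint P (fun w => noise t (mc_y n i w) l n i k w).
Proof.
move=> dsq.
pose gd w := co (g t (mc_y n i w) (x n i l w)) k - co (g t (rk_y n i) (x n i l w)) k.
have mgY : measurable_fun setT (fun w => co (g t (mc_y n i w) (x n i l w)) k).
  apply: (measurable_co_g g_meas g_cont) => //; exact: measurable_mc_y.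
have mgy : measurable_fun setT (fun w => co (g t (rk_y n i) (x n i l w)) k).
  exact: (measurableT_comp (measurable_g g_meas (rk_y n i) k Jt) (measurable_funPT (x n i l))).
have lip_sq (u : Omega -> R) : measurable_fun setT u ->
    (forall w, `|u w| <= L * l2 (arg_err n i w)) -> sqint P u.
  move=> mu uL; have [_ sq2] := sqintZ L (sqintv_l2 dsq).
  apply: sqint_le sq2 => // w.
  by rewrite -[leLHS]real_normK ?num_real// lerXn2r ?nnegrE// ?mulr_ge0 ?l2_ge0.
have sg : sqint P gd.
  apply: lip_sq; first exact: (measurable_funB mgY mgy).
  by move=> w; apply: le_trans (g_lip _ _ _ Jt);
    exact: (l2_coord (fun k => co (g t (mc_y n i w) (x n i l w)) k - co (g t (rk_y n i) (x n i l w)) k)).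
have sd : sqint P (fun w => drift_err n i w k).
  apply: lip_sq; first exact: drift_err_measurable.
  by move=> w; apply: le_trans (f_lip _ _ Jt); exact: (l2_coord (drift_err n i w)).
have [sn _] := noise_sqint l k.
rewrite (_ : (fun w => _) = fun w => noise t (rk_y n i) l n i k w + (gd w - drift_err n i w k)).
  exact: sqintD sn (sqintB sg sd).
apply/funext => w; rewrite /noise /gd /drift_err -/t.
exact: subr_subr_split.
Qed.

Lemma slope_drift_orth (Z : Omega -> R) k : sqintv P (arg_err n i) -> sqint P Z ->
  (forall l, measurable_fun setT (Z : others i nN l -> R)) ->
  Ex P (fun w => Z w * (slope_err n i w k - drift_err n i w k)) = 0.
Proof.
move=> dsq sZ mZ.
have iZ l : integ P (fun w => Z w * noise t (mc_y n i w) l n i k w).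
  by apply: sqintM => //; exact: noise_mc_y_sqint.
rewrite (_ : (fun w => _) = fun w => Ns%:R^-1 * \sum_l Z w * noise t (mc_y n i w) l n i k w).
  rewrite ExZ; last by apply: integ_sum => l _; exact: iZ.
  rewrite Ex_sum => [|l _]; last exact: iZ.
  rewrite big1 ?mulr0// => l _.
  by apply: (@fresh_noise_mean0 n i nN) => //; exact: past_mc_y.
by apply/funext => w; rewrite slope_errB -mulr_sumr mulrCA.
Qed.

End FixedStage.

Section Step.
Hypothesis hA : h * A <= 11^-1.
Variable n : nat.
Hypothesis nN : (n < N)%N.
Hypothesis e_sq : sqintv P (err n).

Let kappa_lip i w :
  l2 (fun k => slope_err n i w k - det_noise n i w k) <= L * l2 (arg_err n i w).
Proof. by apply: slope_err_lip => z u v; exact: g_lip (stageJ i nN). Qed.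

Let drift_lip i w : l2 (drift_err n i w) <= L * l2 (arg_err n i w).
Proof. exact: f_lip (stageJ i nN). Qed.

Lemma arg_err_sq i : sqintv P (arg_err n i).
Proof.
apply: (delta_sq (e := err n) (kappa := slope_err n) (xi := det_noise n)
  h_ge0 L_ge0 Rb_ge0 hA a_bound (arg_errE n) kappa_lip) => //.
- by move=> j k; exact: slope_err_measurable.
- by move=> j; exact: det_noise_sqintv.
Qed.

Lemma errS_sq : sqintv P (err n.+1).
Proof.
apply: (e'_sq (e := err n) (delta := arg_err n) (kappa := slope_err n) (xi := det_noise n)
  h_ge0 L_ge0 Rb_ge0 hA a_bound (arg_errE n) (errS n) kappa_lip) => //.
- by move=> j k; exact: slope_err_measurable.
- by move=> j; exact: det_noise_sqintv.
Qed.

Lemma err_mean_square_step (beta : R) : h * A ^+ 2 <= 1 ->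
  4 + 8 * A ^+ 2 <= beta -> 4 * Rb ^+ 2 * s%:R ^+ 2 <= beta ->
  Ex P (fun w => l2 (err n.+1 w) ^+ 2) <=
    (1 + beta * h) * Ex P (fun w => l2 (err n w) ^+ 2) +
    beta * h ^+ 2 * (sigma2 / Ns%:R).
Proof.
apply: (@mean_square_step _ Omega R P _ s h Rb L (rk_a tab) (rk_b tab) (err n)
  (err n.+1) (arg_err n) (slope_err n) (drift_err n) (det_noise n)
  h_ge0 h_le1 L_ge0 Rb_ge0 hA a_bound b_bound (arg_errE n) (errS n) drift_lip) => //.
- by rewrite divr_ge0.
- by move=> j k; exact: slope_err_measurable.
- by move=> j k; exact: drift_err_measurable.
- by move=> j; exact: det_noise_sqintv.
- by move=> j; exact: det_noise_var.
- move=> j k; apply: slope_drift_orth; first exact: arg_err_sq.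
    exact: e_sq.
  by move=> l; exact: past_err.
Qed.

Lemma err_bias_step (M alpha : R) (D : 'I_s -> 'I_(d + d) -> 'I_(d + d) -> R) :
  0 <= M ->
  (forall i (y : 'I_(d + d) -> R), l2 (fun k => \sum_j D i k j * y j) <= L * l2 y) ->
  (forall i w, l2 (fun k => drift_err n i w k - \sum_j D i k j * arg_err n i w j) <=
     M * l2 (arg_err n i w) ^+ 2) ->
  11 / 10 * A <= alpha -> 27 / 10 * (s%:R * Rb * M) <= alpha ->
  27 / 10 * (s%:R * Rb * M) * (s%:R ^+ 2 * Rb ^+ 2) <= alpha ->
  l2 (Exv P (err n.+1)) <= (1 + alpha * h) * l2 (Exv P (err n)) +
    alpha * h * (Ex P (fun w => l2 (err n w) ^+ 2) + h ^+ 2 * (sigma2 / Ns%:R)).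
Proof.
move=> M0 Dlip taylor.
apply: (@bias_step _ Omega R P _ s h Rb L (rk_a tab) (rk_b tab) (err n)
  (err n.+1) (arg_err n) (slope_err n) (drift_err n) (det_noise n)
  h_ge0 L_ge0 Rb_ge0 hA a_bound b_bound (arg_errE n) (errS n) drift_lip _ _ kappa_lip
  _ _ _ _ _ M D) => //.
- by rewrite divr_ge0.
- by move=> j k; exact: slope_err_measurable.
- by move=> j k; exact: drift_err_measurable.
- by move=> j; exact: det_noise_sqintv.
- by move=> j; exact: det_noise_var.
- move=> j k; have dsq := arg_err_sq j.
  have ssq : sqint P (fun w => slope_err n j w k).
    apply: (kappa_sq (e := err n) (delta := arg_err n) (xi := det_noise n)
      h_ge0 L_ge0 Rb_ge0 hA a_bound (arg_errE n) kappa_lip) => //.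
    + by move=> j' k'; exact: slope_err_measurable.
    + by move=> j'; exact: det_noise_sqintv.
  have phsq : sqint P (fun w => drift_err n j w k).
    apply: (phi_sq (e := err n) (delta := arg_err n) (kappa := slope_err n)
      (phi := drift_err n) (xi := det_noise n)
      h_ge0 L_ge0 Rb_ge0 hA a_bound (arg_errE n) drift_lip kappa_lip) => //.
    + by move=> j' k'; exact: slope_err_measurable.
    + by move=> j' k'; exact: drift_err_measurable.
    + by move=> j'; exact: det_noise_sqintv.
  apply/eqP; rewrite -subr_eq0 -ExB; [|exact: sqint_integ..].
  have := @slope_drift_orth n j nN (fun=> 1) k dsq (sqint_cst P 1).
  move=> orth1; rewrite -[X in X == 0](_ : Ex P (fun w =>
      1 * (slope_err n j w k - drift_err n j w k)) = _); first by rewrite orth1.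
  by congr Ex; apply/funext => w; rewrite mul1r.
Qed.

End Step.
End FiniteVariance.
End Scheme.

(** * The constants alpha and beta *)

Section Constants.
Context (R : realType).

Lemma sqrt_double_le (d : nat) :
  Num.sqrt (d + d)%:R <= 142 / 100 * Num.sqrt d%:R :> R.
Proof.
apply: (@le_trans _ _ (Num.sqrt ((142 / 100) ^+ 2 * d%:R))).
  apply: ler_wsqrtr; rewrite natrD; have := ler0n R d; lra.
by rewrite sqrtrM ?sqr_ge0// sqrtr_sqr ger0_norm.
Qed.

Context (s d : nat) (M1 M2 Rb : R).
Hypotheses (M1_ge0 : 0 <= M1) (M2_ge0 : 0 <= M2) (Rb_ge0 : 0 <= Rb).
Let L := Num.sqrt (d + d)%:R * M1.
Let M := Num.sqrt (d + d)%:R * M2.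
Let A := s%:R * Rb * L.
Let alpha := rk_alpha s d M1 M2 Rb.
Let beta := rk_beta s d M1 Rb.

Let two_s : (0 < s)%N -> 2 <= 2 ^+ s :> R.
Proof. by move=> s0; rewrite -[leLHS]expr1 ler_eXn2l// ltr1n. Qed.

Let q := Num.sqrt d%:R : R.
Let q_ge0 : 0 <= q. Proof. exact: sqrtr_ge0. Qed.

(** Since 2^s >= 2 for s > 0, the factor 2^s of alpha provides a factor 2. *)
Lemma alpha_ge (c : R) : 0 <= c ->
  c <= Num.max M1 (Num.max (2 * s%:R * M2)
    (Num.max (2 ^+ (s + 2) * s%:R ^+ 3 * M1 ^+ 2 * M2 * Rb ^+ 2)
             (2 ^+ (s + 1) * s%:R ^+ 2 * M2 * Rb ^+ 2))) ->
  2 * (s%:R * Rb * q * c) <= alpha.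
Proof.
move=> c0 cm; rewrite /alpha /rk_alpha -/q; set m := Num.max _ _ in cm *.
have [s0|s0] := posnP s; first by rewrite s0 !(mul0r, mulr0).
have sRq : 0 <= s%:R * Rb * q by rewrite !mulr_ge0.
have h1 : s%:R * Rb * q * c <= s%:R * Rb * q * m by rewrite ler_wpM2l.
have h2 : 2 * (s%:R * Rb * q * m) <= 2 ^+ s * (s%:R * Rb * q * m).
  by rewrite ler_wpM2r ?two_s// mulr_ge0// (le_trans c0 cm).
rewrite -!mulrA in h1 h2 *; lra.
Qed.

Lemma alpha_ge0 : 0 <= alpha.
Proof.
have := @alpha_ge 0 (lexx 0); rewrite !mulr0; apply.
by rewrite le_max M1_ge0.
Qed.

(** Here (11/10) sqrt 2 < 2. *)
Lemma alpha_A : 11 / 10 * A <= alpha.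
Proof.
apply: le_trans (alpha_ge M1_ge0 _); last by rewrite le_max lexx.
have sRM : 0 <= s%:R * Rb * M1 by rewrite !mulr_ge0.
have := ler_wpM2l sRM (sqrt_double_le d); rewrite -/q /A /L.
have : 0 <= s%:R * Rb * M1 * q by rewrite mulr_ge0.
lra.
Qed.

(** Here (27/10) sqrt 2 < 4, and the second entry of the maximum is at least
    2 M2. *)
Lemma alpha_M : 27 / 10 * (s%:R * Rb * M) <= alpha.
Proof.
have [s0|s0] := posnP s.
  by rewrite s0 !(mul0r, mulr0); exact: alpha_ge0.
apply: le_trans (@alpha_ge (2 * M2) _ _); last first.
- rewrite !le_max; apply/orP; right; apply/orP; left.
  by rewrite ler_wpM2r// ler_peMr// ler1n.
- by rewrite mulr_ge0.
have sRM : 0 <= s%:R * Rb * M2 by rewrite !mulr_ge0.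
have := ler_wpM2l sRM (sqrt_double_le d); rewrite -/q /M.
have : 0 <= s%:R * Rb * M2 * q by rewrite mulr_ge0.
lra.
Qed.

(** The last entry of the maximum is at least 4 s^2 M2 Rb^2. *)
Lemma alpha_MR : 27 / 10 * (s%:R * Rb * M) * (s%:R ^+ 2 * Rb ^+ 2) <= alpha.
Proof.
have [s0|s0] := posnP s.
  by rewrite s0 !(mul0r, mulr0); exact: alpha_ge0.
have sR2 : 0 <= s%:R ^+ 2 * M2 * Rb ^+ 2 by rewrite !mulr_ge0 ?sqr_ge0.
apply: le_trans (@alpha_ge (4 * (s%:R ^+ 2 * M2 * Rb ^+ 2)) _ _); last first.
- rewrite !le_max; apply/orP; right; apply/orP; right; apply/orP; right.
  rewrite -!mulrA in sR2 *; rewrite ler_wpM2r// exprD expr1.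
  by have := two_s s0; lra.
- by rewrite mulr_ge0.
have sRM : 0 <= s%:R * Rb * (s%:R ^+ 2 * M2 * Rb ^+ 2) by rewrite !mulr_ge0 ?sqr_ge0.
have := ler_wpM2l sRM (sqrt_double_le d); rewrite -/q /M.
have : 0 <= s%:R * Rb * (s%:R ^+ 2 * M2 * Rb ^+ 2) * q by rewrite mulr_ge0.
lra.
Qed.

Lemma alpha_eq0 : (0 < s)%N -> (0 < d)%N -> alpha = 0 -> Rb * L = 0.
Proof.
move=> s0 d0 a0.
have := alpha_ge M1_ge0; rewrite le_max lexx a0 => /(_ isT) h.
have q0 : 0 < q by rewrite sqrtr_gt0 ltr0n.
have : Rb * M1 <= 0.
  rewrite -(@pmulr_rle0 _ (2 * (s%:R * q))) ?mulr_gt0// ?ltr0n//; lra.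
rewrite le_eqVlt ltNge mulr_ge0// orbF => /eqP RM.
by rewrite /L mulrCA RM mulr0.
Qed.

Lemma beta_A : 4 + 8 * A ^+ 2 <= beta.
Proof.
rewrite /beta /rk_beta le_max lerD2l; apply/orP; left.
rewrite /A /L !exprMn sqr_sqrtr// natrD exprD.
have [s0|s0] := posnP s; first by rewrite s0 !(expr0n, mul0r, mulr0).
have X0 : 0 <= M1 ^+ 2 * d%:R * Rb ^+ 2 * s%:R ^+ 2 by rewrite !mulr_ge0 ?sqr_ge0.
have h1 : 1 <= s%:R :> R by rewrite ler1n.
have h2 := two_s s0.
have h3 : 2 <= 2 ^+ s * s%:R :> R by nra.
have := ler_wpM2r X0 h3.
rewrite [2 ^+ 3]exprS [s%:R ^+ 3]exprS; lra.
Qed.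

Lemma beta_R : 4 * Rb ^+ 2 * s%:R ^+ 2 <= beta.
Proof.
rewrite /beta /rk_beta le_max.
have [s0|s0] := posnP s; first by rewrite s0 expr0n !mulr0 lexx orbT.
apply/orP; right; rewrite exprD expr1.
have h2 := two_s s0.
have X0 : 0 <= Rb ^+ 2 * s%:R ^+ 2 by rewrite mulr_ge0 ?sqr_ge0.
have := ler_wpM2r X0 h2; lra.
Qed.

Lemma beta_gt0 : 0 < beta.
Proof. by apply: lt_le_trans beta_A; have := sqr_ge0 A; lra. Qed.

Lemma threshold h : 0 < h -> h <= (11 * (1 + A + A ^+ 2))^-1 ->
  h * A <= 11^-1 /\ h * A ^+ 2 <= 1.
Proof.
have A0 : 0 <= A by rewrite /A /L !mulr_ge0 ?sqrtr_ge0.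
have A2 := sqr_ge0 A.
move=> h0; rewrite -[_^-1]div1r ler_pdivlMr; last by lra.
have : 0 <= h * A by rewrite mulr_ge0// ltW.
have : 0 <= h * A ^+ 2 by rewrite mulr_ge0// ltW.
move=> ? ? ?; split; lra.
Qed.

End Constants.

(** * Variances of the stages *)

Section Std.
Context (R : realType) (d : nat).
Context (d1 : measure_display) (Omega1 : measurableType d1).
Context (P1 : probability Omega1 R).

(** A finite variance makes the sum of the two squares integrable, hence each of
    them. *)
Lemma cvariance_Ex (Z : Omega1 -> R[i]) (z : R[i]) (c : R) :
  measurable_fun setT (fun w => complex.Re (Z w)) ->
  measurable_fun setT (fun w => complex.Im (Z w)) ->
  has_expectation P1 Z z -> (cvariance P1 Z <= c%:E)%E ->
  [/\ integ P1 (fun w => (complex.Re (Z w) - complex.Re z) ^+ 2),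
      integ P1 (fun w => (complex.Im (Z w) - complex.Im z) ^+ 2) &
      cvariance P1 Z = (Ex P1 (fun w => (complex.Re (Z w) - complex.Re z) ^+ 2) +
        Ex P1 (fun w => (complex.Im (Z w) - complex.Im z) ^+ 2))%:E].
Proof.
move=> mR mI [ER EI]; rewrite /cvariance ER EI/=.
set hR := fun w => (complex.Re (Z w) - complex.Re z) ^+ 2.
set hI := fun w => (complex.Im (Z w) - complex.Im z) ^+ 2.
rewrite -/(hR _) => vc.
have mhR : measurable_fun setT hR by apply: measurable_funX; exact: measurable_funB.
have mhI : measurable_fun setT hI by apply: measurable_funX; exact: measurable_funB.
have v0 : (0 <= 'E_P1[fun w => (hR w + hI w)%R])%E.
  by apply: expectation_ge0 => w; rewrite addr_ge0 ?sqr_ge0.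
have vfin : ('E_P1[fun w => (hR w + hI w)%R] \is a fin_num)%E.
  by rewrite ge0_fin_numE// (le_lt_trans vc)// ltry.
have [ih _] := integ_of_expectation (measurable_funD mhR mhI) (esym (fineK vfin)).
have iR : integ P1 hR.
  by apply: integ_le ih => // w; rewrite ger0_norm ?sqr_ge0// lerDl sqr_ge0.
have iI : integ P1 hI.
  by apply: integ_le ih => // w; rewrite ger0_norm ?sqr_ge0// lerDr sqr_ge0.
by split => //; rewrite expectationE// ExD.
Qed.

Context (dE : measure_display) (E : measurableType dE) (X : {RV P1 >-> E}).
Context (J : set R) (s : nat) (tab : explicit_rk R s).
Variables (f : R -> 'CV[R]_d -> 'CV[R]_d) (u0 : 'CV[R]_d).
Variable g : R -> 'CV[R]_d -> E -> 'CV[R]_d.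
Hypothesis g_meas : forall t u m, J t ->
     measurable_fun [set: E] (fun x => complex.Re (g t u x 0 m)) /\
     measurable_fun [set: E] (fun x => complex.Im (g t u x 0 m)).
Hypothesis g_mean : forall t u m, J t ->
     has_expectation P1 (fun w => g t u (X w) 0 m) (f t u 0 m).
Context (N : nat) (h : R).
Hypothesis stageJ : forall (n : nat) (i : 'I_s), (n < N)%N -> J (stage_time tab h n i).

Let stage_var n i m := cvariance P1 (fun w =>
  g (stage_time tab h n i) (det_arg tab f h u0 n i) (X w) 0 m).

Lemma rk_std_coord_ge0 m : (0 <= rk_std_coord X tab f g h u0 N m)%E.
Proof.
rewrite /rk_std_coord; elim/big_ind: _ => // [a b a0 b0|n _].
  by rewrite le_max a0.
elim/big_ind: _ => // [a b a0 b0|i _]; first by rewrite le_max a0.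
exact: sqrte_ge0.
Qed.

Lemma rk_std_sqr : (rk_std X tab f g h u0 N ^+ 2 =
  \sum_m rk_std_coord X tab f g h u0 N m ^+ 2)%E.
Proof. by rewrite sqr_sqrte// sume_ge0// => m _; rewrite expe_ge0// rk_std_coord_ge0. Qed.

Lemma stage_var_ge0 n i m : (0 <= stage_var n i m)%E.
Proof. by apply: expectation_ge0 => w; rewrite addr_ge0 ?sqr_ge0. Qed.

Lemma stage_var_le n i m : (n < N)%N ->
  (stage_var n i m <= rk_std_coord X tab f g h u0 N m ^+ 2)%E.
Proof.
move=> nN; rewrite -(sqr_sqrte (stage_var_ge0 n i m)) !expe2.
have le1 : (sqrte (stage_var n i m) <= rk_std_coord X tab f g h u0 N m)%E.
  rewrite /rk_std_coord.
  apply: (@le_trans _ _ (\big[maxe/0%E]_(i0 < s) sqrte (stage_var n i0 m))).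
    exact: (le_bigmax _ (fun i0 => sqrte (stage_var n i0 m)) i).
  exact: (le_bigmax _ (fun n0 : 'I_N => \big[maxe/0%E]_(i0 < s) sqrte (stage_var n0 i0 m)) (Ordinal nN)).
by apply: lee_pmul => //; exact: sqrte_ge0.
Qed.

(** The sum over the complex coordinates m of the maxima over all stages
    dominates, for each stage, the total variance of its 2d real coordinates. *)
Lemma rk_std_dev (sigma2 : R) : (rk_std X tab f g h u0 N ^+ 2)%E = sigma2%:E ->
  let dev n i k w := co (g (stage_time tab h n i) (rk_y tab f u0 h n i) (X w)) k -
    co (f (stage_time tab h n i) (rk_y tab f u0 h n i)) k in
  (forall n i k, (n < N)%N -> integ P1 (fun w => dev n i k w ^+ 2)) /\
  (forall n i, (n < N)%N -> \sum_k Ex P1 (fun w => dev n i k w ^+ 2) <= sigma2).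
Proof.
rewrite rk_std_sqr => sE dev.
have le_s m : (rk_std_coord X tab f g h u0 N m ^+ 2 <= sigma2%:E)%E.
  rewrite -sE (bigD1 m)//= leeDl// sume_ge0// => m' _.
  by rewrite mule_ge0// rk_std_coord_ge0.
have facts n i m (nN : (n < N)%N) := cvariance_Ex
  (measurableT_comp (g_meas (det_arg tab f h u0 n i) m (stageJ i nN)).1 (measurable_funPT X))
  (measurableT_comp (g_meas (det_arg tab f h u0 n i) m (stageJ i nN)).2 (measurable_funPT X))
  (g_mean (det_arg tab f h u0 n i) m (stageJ i nN))
  (le_trans (stage_var_le i m nN) (le_s m)).
have devl n i m : (fun w => dev n i (lshift d m) w ^+ 2) = (fun w =>
    (complex.Re (g (stage_time tab h n i) (det_arg tab f h u0 n i) (X w) 0 m) -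
     complex.Re (f (stage_time tab h n i) (det_arg tab f h u0 n i) 0 m)) ^+ 2).
  by apply/funext => w; rewrite /dev !co_lshift.
have devr n i m : (fun w => dev n i (rshift d m) w ^+ 2) = (fun w =>
    (complex.Im (g (stage_time tab h n i) (det_arg tab f h u0 n i) (X w) 0 m) -
     complex.Im (f (stage_time tab h n i) (det_arg tab f h u0 n i) 0 m)) ^+ 2).
  by apply/funext => w; rewrite /dev !co_rshift.
split=> [n i k nN|n i nN].
  case: (split_ordP k) => m ->; rewrite ?devl ?devr; have [iR iI _] := facts n i m nN.
    exact: iR.
  exact: iI.
rewrite big_split_ord/= -big_split/= -lee_fin -sE -sumEFin; apply: lee_sum => m _.
apply: le_trans (stage_var_le i m nN).
have [_ _ vE] := facts n i m nN.
by rewrite [leRHS]vE devl devr.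
Qed.

End Std.

(** * Error bounds *)

Lemma norm2_expectationE d (T : measurableType d) (R : realType)
    (P : probability T R) n (Z : T -> 'CV[R]_n) :
  (forall k, integ P (fun w => co (Z w) k)) ->
  norm2_expectation P Z = (l2 (Exv P (fun w => co (Z w))))%:E.
Proof.
move=> iZ; rewrite /norm2_expectation /l2.
have EZ m : ('E_P[fun w => complex.Re (Z w ord0 m)] ^+ 2 +
    'E_P[fun w => complex.Im (Z w ord0 m)] ^+ 2)%E =
    (Exv P (fun w => co (Z w)) (lshift n m) ^+ 2 +
     Exv P (fun w => co (Z w)) (rshift n m) ^+ 2)%:E.
  have := iZ (lshift n m); have := iZ (rshift n m); rewrite /Exv.
  under eq_fun do rewrite co_rshift; move=> iR.
  under eq_fun do rewrite co_lshift; move=> iL.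
  by rewrite !expectationE.
under eq_bigr do rewrite EZ.
by rewrite sumEFin/= big_split_ord/= -big_split.
Qed.

(** The case s = 0 is included by Rb_s0 with Rb = 0, since alpha = 0 should imply
    that the weights or the gradients vanish. *)
Section ErrorBounds.
Context (R : realType) (T : R) (d : nat) (J : set R).
Context (s p : nat) (tab : explicit_rk R s).
Variables (f : R -> 'CV[R]_d -> 'CV[R]_d) (u0 : 'CV[R]_d).
Context (d1 : measure_display) (Omega1 : measurableType d1).
Context (P1 : probability Omega1 R).
Context (dE : measure_display) (E : measurableType dE) (X : {RV P1 >-> E}).
Variables (g : R -> 'CV[R]_d -> E -> 'CV[R]_d) (M1 M2 Rb : R).
Hypotheses (T_gt0 : 0 < T) (d_gt0 : (0 < d)%N) (f_smooth : Ck_on J p.+2 f).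
Hypothesis g_meas : forall t u m, J t ->
     measurable_fun [set: E] (fun x => complex.Re (g t u x 0 m)) /\
     measurable_fun [set: E] (fun x => complex.Im (g t u x 0 m)).
Hypothesis g_mean : forall t u m, J t ->
     has_expectation P1 (fun w => g t u (X w) 0 m) (f t u 0 m).
Hypothesis g_diff : forall t u x m, J t -> rdifferentiable (fun v => g t v x 0 m) u.
Hypothesis g_grad : forall t u x m, J t -> grad_norm (fun v => g t v x 0 m) u <= M1.
Hypothesis f_grad : forall t u m, J t -> grad_norm (fun v => f t v 0 m) u <= M1.
Hypothesis f_hess : forall t u m, J t -> hess_norm (fun v => f t v 0 m) u <= M2.
Hypothesis a_bound : forall i j : 'I_s, (j < i)%N -> `|rk_a tab i j| <= Rb.
Hypothesis b_bound : forall i : 'I_s, `|rk_b tab i| <= Rb.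
Hypotheses (M1_ge0 : 0 <= M1) (M2_ge0 : 0 <= M2) (Rb_ge0 : 0 <= Rb).
Hypothesis Rb_s0 : s = 0 -> Rb = 0.
Context (N Ns : nat).
Hypotheses (N_gt0 : (0 < N)%N) (Ns_gt0 : (0 < Ns)%N).
Let h := T / N%:R.
Let L := Num.sqrt (d + d)%:R * M1.
Let M := Num.sqrt (d + d)%:R * M2.
Let A := s%:R * Rb * L.
Hypotheses (h_lt1 : h < 1) (h_small : h <= (11 * (1 + A + A ^+ 2))^-1).
Hypothesis stageJ : forall (n : nat) (i : 'I_s), (n < N)%N -> J (stage_time tab h n i).
Context (d2 : measure_display) (Omega : measurableType d2).
Context (P : probability Omega R) (x : nat -> 'I_s -> 'I_Ns -> {RV P >-> E}).
Hypothesis iid : iid_samples X N x.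

Let h_gt0 : 0 < h. Proof. by rewrite divr_gt0// ltr0n. Qed.
Let Nh : N%:R * h = T.
Proof. by rewrite mulrC divfK// pnatr_eq0 -lt0n. Qed.
Let L_ge0 : 0 <= L. Proof. by rewrite mulr_ge0 ?sqrtr_ge0. Qed.
Let M_ge0 : 0 <= M. Proof. by rewrite mulr_ge0 ?sqrtr_ge0. Qed.
Let hA : h * A <= 11^-1.
Proof. by have [] := threshold M1_ge0 Rb_ge0 h_gt0 h_small. Qed.
Let hA2 : h * A ^+ 2 <= 1.
Proof. by have [] := threshold M1_ge0 Rb_ge0 h_gt0 h_small. Qed.

Let g_grad_derivable t z k : J t -> grad_derivable (coord (fun u => g t u z) k).
Proof.
move=> Jt; apply: differentiable_grad_derivable => y; rewrite -[y]complexifyK.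
by apply: rdifferentiable_coord => m; exact: g_diff.
Qed.

Let g_cont t z k : J t -> continuous (coord (fun u => g t u z) k).
Proof.
move=> Jt y; rewrite -[y]complexifyK; apply: differentiable_continuous.
by apply: rdifferentiable_coord => m; exact: g_diff.
Qed.

Let f_cont t k : J t -> continuous (coord (f t) k).
Proof. by move=> Jt; have [] := Ck_on_coord k f_smooth Jt. Qed.

Let f_grad_derivable t k : J t -> grad_derivable (coord (f t) k).
Proof. by move=> Jt; have [] := Ck_on_coord k f_smooth Jt. Qed.

Let g_lip t z u v : J t ->
  l2 (fun k => co (g t v z) k - co (g t u z) k) <= L * l2 (fun k => co v k - co u k).
Proof.
move=> Jt; apply: (lipschitz_co (G := fun u => g t u z)) => // [k|w m].
  exact: g_grad_derivable.
exact: g_grad.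
Qed.

Let f_lip t u v : J t ->
  l2 (fun k => co (f t v) k - co (f t u) k) <= L * l2 (fun k => co v k - co u k).
Proof.
move=> Jt; apply: (lipschitz_co (G := f t)) => // [k|w m].
  exact: f_grad_derivable.
exact: f_grad.
Qed.

Let alpha := rk_alpha s d M1 M2 Rb.
Let beta := rk_beta s d M1 Rb.
Let std := rk_std X tab f g h u0 N.
Let uN := det_sol tab f h u0 N.
Let vN w := mc_sol tab g h u0 (fun n i l => x n i l w) N.
Let errn n := err tab f u0 g h x n.

Let co_diff w k : co (uN - vN w) k = - errn N w k.
Proof. by rewrite coB opprB. Qed.

Let l2_diff w : l2 (co (uN - vN w)) = l2 (errn N w).
Proof. by rewrite (eq_l2 (co_diff w)) l2N. Qed.

Let norm2_expectation_err : (forall k, integ P (fun w => errn N w k)) ->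
  norm2_expectation P (fun w => uN - vN w) = (l2 (Exv P (errn N)))%:E.
Proof.
move=> ie.
have ic k : integ P (fun w => co (uN - vN w) k).
  by under eq_fun do rewrite co_diff; exact: integN.
rewrite norm2_expectationE//; congr EFin; rewrite -[RHS]l2N; apply: eq_l2 => k.
by rewrite /Exv -ExN//; under eq_fun do rewrite co_diff.
Qed.

Lemma err_bounds_finite (sigma2 : R) : (std ^+ 2)%E = sigma2%:E -> 0 <= sigma2 ->
  [/\ sqintv P (errn N),
      Ex P (fun w => l2 (errn N w) ^+ 2) <=
        (expR (beta * T) - 1) * (h * (sigma2 / Ns%:R)) &
      l2 (Exv P (errn N)) <=
        (expR (alpha * T) - 1) * (h ^+ 2 * (sigma2 / Ns%:R)) +
        alpha * T * (expR (Num.max alpha beta * T) - 1) * (h * (sigma2 / Ns%:R))].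
Proof.
move=> sE s0.
have [dsq dvar] := rk_std_dev g_meas g_mean stageJ sE.
have h0 := ltW h_gt0; have h1 := ltW h_lt1.
have esq n : (n <= N)%N -> sqintv P (errn n).
  elim: n => [_ k|n IH nN].
    by rewrite /errn; under eq_fun do rewrite err0; exact: sqint_cst.
  exact: (errS_sq g_meas g_cont Ns_gt0 stageJ iid h0 L_ge0 Rb_ge0
    a_bound g_lip dsq hA nN (IH (ltnW nN))).
have v0 : 0 <= sigma2 / Ns%:R by rewrite divr_ge0.
have a0 : 0 <= alpha by exact: alpha_ge0.
have b0 : 0 <= beta by exact: ltW (beta_gt0 _ _ _ _).
have Vstep n : (n < N)%N -> Ex P (fun w => l2 (errn n.+1 w) ^+ 2) <=
    (1 + beta * h) * Ex P (fun w => l2 (errn n w) ^+ 2) +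
    beta * h ^+ 2 * (sigma2 / Ns%:R).
  move=> nN.
  apply: (err_mean_square_step g_meas g_mean g_cont f_cont Ns_gt0 stageJ iid h0 h1
    L_ge0 Rb_ge0 a_bound b_bound g_lip f_lip s0 dsq dvar hA nN (esq n (ltnW nN))) => //.
    exact: beta_A.
  exact: beta_R.
have Bstep n : (n < N)%N -> l2 (Exv P (errn n.+1)) <=
    (1 + alpha * h) * l2 (Exv P (errn n)) +
    alpha * h * (Ex P (fun w => l2 (errn n w) ^+ 2) + h ^+ 2 * (sigma2 / Ns%:R)).
  move=> nN.
  (* The Jacobian of f at the deterministic argument of stage i. *)
  pose D i k j := partial j (coord (f (stage_time tab h n i)) k)
    (realify (rk_y tab f u0 h n i)).
  apply: (err_bias_step g_meas g_mean g_cont f_cont Ns_gt0 stageJ iid h0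
    L_ge0 Rb_ge0 a_bound b_bound g_lip f_lip s0 dsq dvar hA nN (esq n (ltnW nN))
    (M := M) (D := D)) => //.
  - move=> i y; apply: grad_co_lipschitz => // u m; exact/f_grad/stageJ.
  - move=> i w; apply: taylor_co => // [k|k j|u m].
    + exact/f_grad_derivable/stageJ.
    + by have [_ _] := Ck_on_coord k f_smooth (stageJ i nN); exact.
    + exact/f_hess/stageJ.
  - exact: alpha_A.
  - exact: alpha_M.
  - exact: alpha_MR.
split; first exact: esq.
- rewrite -Nh; apply: (mean_square_gronwall (V := fun n => Ex P (fun w => l2 (errn n w) ^+ 2))) => //.
  rewrite (_ : (fun w => _) = fun=> 0) ?Ex_cst//; apply/funext => w.
  by rewrite (eq_l2 (err0 _ _ _ _ _ _ w)) l2_0 expr0n.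
- rewrite -Nh; apply: (bias_gronwall (V := fun n => Ex P (fun w => l2 (errn n w) ^+ 2))
    (B := fun n => l2 (Exv P (errn n)))) => //.
    rewrite (_ : (fun w => _) = fun=> 0) ?Ex_cst//; apply/funext => w.
    by rewrite (eq_l2 (err0 _ _ _ _ _ _ w)) l2_0 expr0n.
  rewrite -[RHS](@l2_0 R 'I_(d + d)); apply: eq_l2 => k.
  by rewrite /Exv /errn; under eq_fun do rewrite err0; exact: Ex_cst.
Qed.

Lemma error_bounds :
  let S := ((h / Ns%:R)%:E +
    (alpha ^+ 2 * h ^+ 4 / (s%:R ^+ 2 * Rb ^+ 2 * Ns%:R ^+ 2))%:E
      * std ^+ 2)%E in
  (norm2_expectation P (fun w => (uN - vN w)%R)
   <= ((h ^+ 2 / Ns%:R * (expR (alpha * T) - 1))%:E +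
       (alpha * T)%:E * S * (expR (Num.max alpha beta * T) - 1)%:E)
      * std ^+ 2)%E /\
  ('E_P[fun w => (norm2 (uN - vN w) ^+ 2)%R]
   <= (expR (beta * T) - 1)%:E * S * std ^+ 2)%E.
Proof.
move=> S.
have a0 : 0 <= alpha by exact: alpha_ge0.
have b0 : 0 < beta by exact: beta_gt0.
have Ns0 : 0 < Ns%:R :> R by rewrite ltr0n.
have T0 := ltW T_gt0; have h0 := ltW h_gt0.
have ea : 0 <= expR (alpha * T) - 1 by rewrite subr_ge0 -expR0 ler_expR mulr_ge0.
have eb : 0 < expR (beta * T) - 1 by rewrite subr_gt0 -expR0 ltr_expR mulr_gt0.
have em : 0 <= expR (Num.max alpha beta * T) - 1.
  by rewrite subr_ge0 -expR0 ler_expR mulr_ge0// le_max a0.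
set c := alpha ^+ 2 * h ^+ 4 / (s%:R ^+ 2 * Rb ^+ 2 * Ns%:R ^+ 2) in S *.
have c0 : 0 <= c.
  apply: divr_ge0; first by apply: mulr_ge0; exact: exprn_ge0.
  by apply: mulr_ge0; [apply: mulr_ge0|]; apply: exprn_ge0.
have std0 : (0 <= std ^+ 2)%E by rewrite expe_ge0// sqrte_ge0.
have S0 : (0 < S)%E.
  apply: lt_le_trans (leeDl _ (mule_ge0 _ _)) => //.
  by rewrite lte_fin divr_gt0.
have C1 : 0 <= h ^+ 2 / Ns%:R * (expR (alpha * T) - 1).
  by apply: mulr_ge0 => //; apply: divr_ge0; [exact: exprn_ge0|exact: ltW].
have C2 : (0 <= (alpha * T)%:E * S * (expR (Num.max alpha beta * T) - 1)%:E)%E.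
  apply: mule_ge0; last by rewrite lee_fin.
  by apply: mule_ge0; [rewrite lee_fin mulr_ge0|exact: ltW].
(* With an infinite standard deviation, the products on the right are +oo as
   soon as their real factors are positive; for alpha = 0 the first one is 0. *)
have [sy|sfin] := eqVneq (std ^+ 2)%E +oo%E.
  rewrite sy; split; last by rewrite gt0_muley ?leey// mule_gt0.
  have [al0|al0] := eqVneq alpha 0.
    have RL0 : Rb * L = 0.
      have [s0|s0] := posnP s; first by rewrite Rb_s0 ?mul0r.
      exact: (alpha_eq0 M1_ge0 Rb_ge0 s0 d_gt0 al0).
    have [ie e0] := noiseless_mean u0 g_meas g_mean Ns_gt0 stageJ iid b_bound g_lip
      (leqnn N) RL0.
    rewrite norm2_expectation_err// (eq_l2 e0) l2_0.
    by apply: mule_ge0 => //; apply: adde_ge0.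
  have al1 : 0 < alpha by rewrite lt0r al0.
  rewrite gt0_muley ?leey//; apply: lt_le_trans (leeDl _ _).
    rewrite lte_fin mulr_gt0 ?divr_gt0 ?exprn_gt0// subr_gt0 -expR0 ltr_expR.
    exact: mulr_gt0.
  exact: C2.
have s2fin : (std ^+ 2)%E \is a fin_num by rewrite ge0_fin_numE// ltey.
pose sigma2 := fine (std ^+ 2)%E.
have sE : (std ^+ 2)%E = sigma2%:E by rewrite fineK.
have s20 : 0 <= sigma2 by rewrite fine_ge0.
have [esq V B] := err_bounds_finite sE s20.
rewrite /S sE; split.
  rewrite norm2_expectation_err => [|k]; last exact/sqint_integ/esq.
  rewrite -!(EFinM, EFinD) lee_fin; apply: le_trans B _.
  have : 0 <= alpha * T * (c * sigma2) * (expR (Num.max alpha beta * T) - 1) * sigma2.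
    by do 2 (apply: mulr_ge0 => //); apply: mulr_ge0; exact: mulr_ge0.
  lra.
under [X in 'E_P[X]%E]eq_fun do rewrite norm2E l2_diff.
rewrite expectationE; last by case: (sqintv_l2 esq).
rewrite -!(EFinM, EFinD) lee_fin; apply: le_trans V _.
have : 0 <= (expR (beta * T) - 1) * (c * sigma2) * sigma2.
  by apply: mulr_ge0 => //; apply: mulr_ge0; [exact: ltW|exact: mulr_ge0].
lra.
Qed.

End ErrorBounds.

Theorem theorem2 (R : realType)
  (T : R) (T_gt0 : 0 < T) (d : nat) (d_gt0 : (0 < d)%N)
  (* the set of times at which f and g are given; [0, T] when 0 <= c_i <= 1 *)
  (J : set R) (J_sub : `[0, T] `<=` J)
  (* the s-stage explicit Runge-Kutta method, of order p *)
  (s p : nat) (p_gt0 : (0 < p)%N) (tab : explicit_rk R s)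
  (tab_order : rk_order tab p)
  (* the right-hand side and the initial value *)
  (f : R -> 'CV[R]_d -> 'CV[R]_d) (u0 : 'CV[R]_d)
  (f_smooth : Ck_on J p.+1 f)
  (* the random variable X and f(t,u) = E_X[g(t,u,X)] *)
  (d1 : measure_display) (Omega1 : measurableType d1)
  (P1 : probability Omega1 R)
  (dE : measure_display) (E : measurableType dE) (X : {RV P1 >-> E})
  (g : R -> 'CV[R]_d -> E -> 'CV[R]_d)
  (g_meas : forall t u m, J t ->
     measurable_fun [set: E] (fun x => complex.Re (g t u x 0 m)) /\
     measurable_fun [set: E] (fun x => complex.Im (g t u x 0 m)))
  (g_mean : forall t u m, J t ->
     has_expectation P1 (fun w => g t u (X w) 0 m) (f t u 0 m))
  (* boundedness hypotheses *)
  (M1 M2 Rb : R)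
  (g_diff : forall t u x m, J t -> rdifferentiable (fun v => g t v x 0 m) u)
  (g_grad : forall t u x m, J t -> grad_norm (fun v => g t v x 0 m) u <= M1)
  (f_grad : forall t u m, J t -> grad_norm (fun v => f t v 0 m) u <= M1)
  (f_hess : forall t u m, J t -> hess_norm (fun v => f t v 0 m) u <= M2)
  (a_bound : forall i j : 'I_s, (j < i)%N -> `|rk_a tab i j| <= Rb)
  (b_bound : forall i : 'I_s, `|rk_b tab i| <= Rb)
  (c_bound : forall i : 'I_s, `|rk_c tab i| <= Rb) :
  exists (h0 : R) (N0 : nat), 0 < h0 /\
  forall (N Ns : nat), (0 < N)%N -> T / N%:R < 1 -> T / N%:R <= h0 ->
  (N0 <= Ns)%N ->
  let h := T / N%:R in
  (* the scheme only evaluates f and g at times where they are defined *)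
  (forall (n : nat) (i : 'I_s), (n < N)%N -> J (stage_time tab h n i)) ->
  forall (d2 : measure_display) (Omega : measurableType d2)
    (P : probability Omega R)
    (x : nat -> 'I_s -> 'I_Ns -> {RV P >-> E}),
  iid_samples X N x ->
  let uN := det_sol tab f h u0 N in
  let vN := fun w : Omega => mc_sol tab g h u0 (fun n i l => x n i l w) N in
  let alpha := rk_alpha s d M1 M2 Rb in
  let beta := rk_beta s d M1 Rb in
  let std := rk_std X tab f g h u0 N in
  let S := ((h / Ns%:R)%:E +
    (alpha ^+ 2 * h ^+ 4 / (s%:R ^+ 2 * Rb ^+ 2 * Ns%:R ^+ 2))%:E
      * std ^+ 2)%E in
  (norm2_expectation P (fun w => (uN - vN w)%R)
   <= ((h ^+ 2 / Ns%:R * (expR (alpha * T) - 1))%:E +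
       (alpha * T)%:E * S * (expR (Num.max alpha beta * T) - 1)%:E)
      * std ^+ 2)%E /\
  ('E_P[fun w => (norm2 (uN - vN w) ^+ 2)%R]
   <= (expR (beta * T) - 1)%:E * S * std ^+ 2)%E.
Proof.
case: p p_gt0 {tab_order} f_smooth => // p' _ f_smooth.
have JT : J T by apply: J_sub; rewrite /= in_itv/= lexx ltW.
have M1_ge0 : 0 <= M1 := le_trans (sqrtr_ge0 _) (f_grad T 0 (Ordinal d_gt0) JT).
have M2_ge0 : 0 <= M2 := le_trans (sqrtr_ge0 _) (f_hess T 0 (Ordinal d_gt0) JT).
(* For s = 0 the bound Rb may be negative; all constants of the statement are
   then the same as for Rb = 0. *)
pose Rb' := if s == 0 then 0 else Rb.
have Rb'E (i : 'I_s) (c : R) : `|c| <= Rb -> `|c| <= Rb'.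
  by rewrite /Rb'; case: eqP => // s0; have := ltn_ord i; rewrite {2}s0.
have Rb'_ge0 : 0 <= Rb'.
  rewrite /Rb'; have [//|s_neq0] := eqVneq s 0.
  rewrite -lt0n in s_neq0; exact: le_trans (normr_ge0 _) (b_bound (Ordinal s_neq0)).
pose A := s%:R * Rb' * (Num.sqrt (d + d)%:R * M1).
have A_ge0 : 0 <= A by rewrite !mulr_ge0 ?sqrtr_ge0.
(* This threshold ensures h * A <= 1/11 and h * A^2 <= 1; one sample is
   enough. *)
exists (11 * (1 + A + A ^+ 2))^-1, 1; split.
  by rewrite invr_gt0 mulr_gt0// -addrA ltr_pwDl// addr_ge0// sqr_ge0.
move=> N Ns N_gt0 h_lt1 h_small Ns_gt0 h stageJ d2 Omega P x iid uN vN.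
have := @error_bounds R T d J s p' tab f u0 d1 Omega1 P1 dE E X g M1 M2 Rb'
  T_gt0 d_gt0 f_smooth g_meas g_mean g_diff g_grad f_grad f_hess _ _ M1_ge0 M2_ge0
  Rb'_ge0 _ N Ns N_gt0 Ns_gt0 h_lt1 h_small stageJ d2 Omega P x iid.
have -> : rk_alpha s d M1 M2 Rb' = rk_alpha s d M1 M2 Rb.
  by rewrite /rk_alpha /Rb'; case: eqP => // ->; rewrite !(mulr0, mul0r).
have -> : rk_beta s d M1 Rb' = rk_beta s d M1 Rb.
  by rewrite /rk_beta /Rb'; case: eqP => // ->; rewrite !expr0n !mulr0.
have -> : s%:R ^+ 2 * Rb' ^+ 2 = s%:R ^+ 2 * Rb ^+ 2.
  by rewrite /Rb'; case: eqP => // ->; rewrite !expr0n !mul0r.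
apply => [i j ji|i|s0].
- exact: Rb'E i _ (a_bound i j ji).
- exact: Rb'E i _ (b_bound i).
- by rewrite /Rb' s0.
Qed.
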